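(* Let $m\in\mathbb{R}$, $A:\mathbb{R}^3\to\mathbb{R}^3$, and assume that the operator $\mathcal{H}=i^{-1}\alpha\cdot\nabla_A+m\beta$ satisfies the self-adjointness assumption (A). Let $\phi:\mathbb{R}^3\to\mathbb{R}$ be a real valued function. Then any solution $u(t,x)$, $u:\mathbb{R}\times\mathbb{R}^3\to\mathbb{C}^4$, of $$iu_t(t,x)+\mathcal{H}u(t,x)=0,\qquad u(0,x)=f(x),$$ satisfies the formal virial identity $$2\int_{\mathbb{R}^3}\nabla_Au\,D^2\phi\,\overline{\nabla_Au}\,dx-\frac12\int_{\mathbb{R}^3}|u|^2\Delta^2\phi\,dx+2\,\Im\int_{\mathbb{R}^3}u\,\phi'B_\tau\cdot\overline{\nabla_Au}\,dx+2\int_{\mathbb{R}^3}\big[S\cdot(DB\,\nabla\phi)u\big]\cdot\overline{u}\,dx$$ $$=-\frac{d}{dt}\,\Re\left(\int_{\mathbb{R}^3}u_t\,\big(2\nabla\phi\cdot\overline{\nabla_Au}+\overline{u}\,\Delta\phi\big)\,dx\right).$$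
   Context: Dirac matrices: in $2\times2$ blocks, $\alpha_k=\begin{pmatrix}0&\sigma_k\\ \sigma_k&0\end{pmatrix}$ for $k=1,2,3$ and $\beta=\begin{pmatrix}I_2&0\\0&-I_2\end{pmatrix}$, where $I_2$ is the $2\times 2$ identity, $\sigma_1=\begin{pmatrix}0&1\\1&0\end{pmatrix}$, $\sigma_2=\begin{pmatrix}0&-i\\i&0\end{pmatrix}$, $\sigma_3=\begin{pmatrix}1&0\\0&-1\end{pmatrix}$. Covariant derivatives: $\nabla_A=\nabla-iA$, with components $\partial_k^A=\partial_k-iA^k$; $\mathcal{H}=i^{-1}\sum_{k=1}^3\alpha_k(\partial_k-iA^k)+m\beta$. Self-adjointness assumption (A): $\mathcal{H}$ is essentially selfadjoint on $C_c^\infty(\mathbb{R}^3;\mathbb{C}^4)$ and, in addition, for initial data $f\in C_c^\infty(\mathbb{R}^3;\mathbb{C}^4)$, the flow $e^{it\mathcal{H}}f$ belongs to $C(\mathbb{R},H^{3/2})$. Magnetic field: $B=\operatorname{curl}A$, $B_\tau=\frac{x}{|x|}\wedge B$ ($\wedge$ is the vector product in $\mathbb{R}^3$), $DB=[\partial_jB_i]_{i,j=1,2,3}$, so $(DB\,\nabla\phi)_i=\sum_j\partial_jB_i\,\partial_j\phi$. Spin operator: $S=(S^1,S^2,S^3)=-\frac i4\,\alpha\wedge\alpha=-\frac i4(\alpha_2\alpha_3-\alpha_3\alpha_2,\ \alpha_3\alpha_1-\alpha_1\alpha_3,\ \alpha_1\alpha_2-\alpha_2\alpha_1)$, and $S\cdot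 V=\sum_iV_iS^i$. Conventions: $\phi'=\frac{x}{|x|}\cdot\nabla\phi$ is the radial derivative of $\phi$, $D^2\phi$ is the Hessian matrix, $\nabla_Au\,D^2\phi\,\overline{\nabla_Au}=\sum_{j,k}\partial_j\partial_k\phi\;\partial_j^Au\cdot\overline{\partial_k^Au}$, $\;u\,\phi'B_\tau\cdot\overline{\nabla_Au}=\sum_j\phi'\,(B_\tau)_j\;u\cdot\overline{\partial_j^Au}$, $\;u_t\,\nabla\phi\cdot\overline{\nabla_Au}=\sum_j\partial_j\phi\;u_t\cdot\overline{\partial_j^Au}$, where $v\cdot\overline{w}$ denotes the Hermitian product of $\mathbb{C}^4$. ''Formal'' means that the identity is asserted for $u$, $\phi$ and $A$ regular enough that all the terms and the integrations by parts involved make sense.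
   Formalization: The identity as printed is proved for radial φ; for general real φ the field φ'B_τ is replaced by ∇φ∧B (equal if φ is radial), as the printed formula fails otherwise; ''formal'' is taken as A∈C², φ∈C⁴, u∈C² with an integrable bound on the terms, locally uniform in t. *)

(* Defs.v *)
From HB Require Import structures.
From mathcomp Require Import all_boot all_order all_algebra.
From mathcomp Require Import all_classical all_reals all_analysis.
From mathcomp Require Import complex.

Set Implicit Arguments.
Unset Strict Implicit.
Unset Printing Implicit Defensive.

Import Order.TTheory GRing.Theory Num.Theory.
Import numFieldNormedType.Exports.

Local Open Scope classical_set_scope.
Local Open Scope ring_scope.
Local Open Scope complex_scope.

Local Notation Re := complex.Re.
Local Notation Im := complex.Im.

(* Points of R^3 are row vectors, with components indexed from 0. The library's
   norm on 'rV is the sup norm, hence the separate Euclidean norm [enorm]. *)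
Definition spinor_field (R : realType) : Type := 'rV[R]_3 -> 'cV[R[i]]_4.

Definition imag (R : realType) : R[i] := 0 +i* 1.
Arguments imag {R}.

Definition dotp (R : realType) (v w : 'rV[R]_3) : R := \sum_k v 0 k * w 0 k.
Definition enorm (R : realType) (v : 'rV[R]_3) : R := Num.sqrt (dotp v v).

(* Addition on 'I_3 is modulo 3. *)
Definition cross (R : realType) (v w : 'rV[R]_3) : 'rV[R]_3 :=
  \row_(k < 3) (v 0 (k + 1) * w 0 (k + 2) - v 0 (k + 2) * w 0 (k + 1)).

Definition hdot (R : realType) (v w : 'cV[R[i]]_4) : R[i] :=
  \sum_a v a 0 * conjc (w a 0).
Definition sqnorm (R : realType) (v : 'cV[R[i]]_4) : R :=
  \sum_a (Re (v a 0) ^+ 2 + Im (v a 0) ^+ 2).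

Definition mx2 (R : realType) (a b c d : R[i]) : 'M[R[i]]_2 :=
  \matrix_(i < 2, j < 2) nth 0 (nth [::] [:: [:: a; b]; [:: c; d]] i) j.

Definition pauli (R : realType) (k : 'I_3) : 'M[R[i]]_2 :=
  nth 0 [:: mx2 0 1 1 0; mx2 0 (- imag) imag 0; mx2 1 0 0 (- 1)] k.

Definition alpha (R : realType) (k : 'I_3) : 'M[R[i]]_4 :=
  block_mx (0 : 'M[R[i]]_2) (pauli R k) (pauli R k) (0 : 'M[R[i]]_2).
Definition beta (R : realType) : 'M[R[i]]_4 :=
  block_mx (1%:M : 'M[R[i]]_2) (0 : 'M[R[i]]_2) (0 : 'M[R[i]]_2) (- 1%:M : 'M[R[i]]_2).

Definition spin (R : realType) (k : 'I_3) : 'M[R[i]]_4 :=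
  (- (imag / 4%:R)) *:
    (alpha R (k + 1) *m alpha R (k + 2) - alpha R (k + 2) *m alpha R (k + 1)).
Definition spin_dot (R : realType) (v : 'rV[R]_3) : 'M[R[i]]_4 :=
  \sum_k (v 0 k)%:C *: spin R k.

Definition partial (R : realType) (k : 'I_3) (f : 'rV[R]_3 -> R) :
    'rV[R]_3 -> R :=
  fun x => 'D_(delta_mx 0 k) f x.
Definition partials (R : realType) (s : seq 'I_3) (f : 'rV[R]_3 -> R) :
    'rV[R]_3 -> R :=
  foldr (@partial R) f s.
Definition gradient (R : realType) (f : 'rV[R]_3 -> R) (x : 'rV[R]_3) :
    'rV[R]_3 :=
  \row_k partial k f x.
Definition laplacian (R : realType) (f : 'rV[R]_3 -> R) : 'rV[R]_3 -> R :=
  fun x => \sum_k partial k (partial k f) x.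
Definition radial_derivative (R : realType) (f : 'rV[R]_3 -> R)
    (x : 'rV[R]_3) : R :=
  dotp ((enorm x)^-1 *: x) (gradient f x).

Definition spinor_partial (R : realType) (k : 'I_3) (f : spinor_field R) :
    spinor_field R :=
  fun x => \col_a (partial k (fun y => Re (f y a 0)) x +i*
                   partial k (fun y => Im (f y a 0)) x).
Definition time_derivative (R : realType) (u : R -> spinor_field R) :
    R -> spinor_field R :=
  fun t x => \col_a (derive1 (fun s => Re (u s x a 0)) t +i*
                     derive1 (fun s => Im (u s x a 0)) t).

(* [Ck n f]: f has continuous iterated directional derivatives up to order n,
   in all directions of V. *)
Fixpoint Ck (R : realType) (V : normedModType R) (n : nat) (f : V -> R) :
    Prop :=
  continuous f /\
  if n is n'.+1 then
    forall v : V, (forall x, derivable f x v) /\ Ck n' (fun x => 'D_v f x)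
  else True.

Definition radial (R : realType) (f : 'rV[R]_3 -> R) : Prop :=
  forall x y, enorm x = enorm y -> f x = f y.

(* Integration on R^3: the library has no Lebesgue measure on 'rV, so integrals
   are taken over (R * R) * R with the product measure. *)

Definition vec3 (R : realType) (p : R * R * R) : 'rV[R]_3 :=
  \row_(k < 3) nth 0 [:: p.1.1; p.1.2; p.2] k.
Definition leb3 (R : realType) :=
  ((@lebesgue_measure R \x @lebesgue_measure R) \x @lebesgue_measure R)%E.
Arguments leb3 R : clear implicits.

Definition integrable3 (R : realType) (f : 'rV[R]_3 -> R) : Prop :=
  (leb3 R).-integrable setT (fun p => (f (vec3 p))%:E).
Definition int3 (R : realType) (f : 'rV[R]_3 -> R) : R :=
  (\int[leb3 R]_p f (vec3 p))%R.
Definition cint3 (R : realType) (f : 'rV[R]_3 -> R[i]) : R[i] :=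
  int3 (fun x => Re (f x)) +i* int3 (fun x => Im (f x)).

Definition curl (R : realType) (A : 'rV[R]_3 -> 'rV[R]_3) (x : 'rV[R]_3) :
    'rV[R]_3 :=
  \row_(k < 3) (partial (k + 1) (fun y => A y 0 (k + 2)) x -
                partial (k + 2) (fun y => A y 0 (k + 1)) x).
Definition curl_tau (R : realType) (A : 'rV[R]_3 -> 'rV[R]_3)
    (x : 'rV[R]_3) : 'rV[R]_3 :=
  cross ((enorm x)^-1 *: x) (curl A x).
Definition Dcurl (R : realType) (A : 'rV[R]_3 -> 'rV[R]_3) (x : 'rV[R]_3) :
    'M[R]_3 :=
  \matrix_(i, j) partial j (fun y => curl A y 0 i) x.

Definition cov (R : realType) (A : 'rV[R]_3 -> 'rV[R]_3) (k : 'I_3)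
    (f : spinor_field R) : spinor_field R :=
  fun x => spinor_partial k f x - (imag * (A x 0 k)%:C) *: f x.
Definition dirac_op (R : realType) (m : R) (A : 'rV[R]_3 -> 'rV[R]_3)
    (f : spinor_field R) : spinor_field R :=
  fun x => imag^-1 *: (\sum_k alpha R k *m cov A k f x) +
           m%:C *: (beta R *m f x).

(* L^2(R^3;C^4). Fields are not quotiented by a.e. equality: every notion
   below is invariant under modification on a null set. *)

Definition sqL2 (R : realType) (f : spinor_field R) : \bar R :=
  (\int[leb3 R]_p (sqnorm (f (vec3 p)))%:E)%E.
Definition measurable_field (R : realType) (f : spinor_field R) : Prop :=
  forall a, measurable_fun setT (fun p => Re (f (vec3 p) a 0)) /\
            measurable_fun setT (fun p => Im (f (vec3 p) a 0)).
Definition inL2 (R : realType) (f : spinor_field R) : Prop :=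
  measurable_field f /\ (sqL2 f < +oo)%E.
Definition dotL2 (R : realType) (f g : spinor_field R) : R[i] :=
  cint3 (fun x => hdot (f x) (g x)).
Definition cvgL2 (R : realType) (fs : nat -> spinor_field R)
    (f : spinor_field R) : Prop :=
  (fun n => sqL2 (fun x => fs n x - f x)) @ \oo --> 0%E.

Definition test_field (R : realType) (f : spinor_field R) : Prop :=
  (forall n a, Ck n (fun x => Re (f x a 0)) /\
               Ck n (fun x => Im (f x a 0))) /\
  exists r : R, forall x, r < enorm x -> f x = 0.

(* Unbounded operators on L^2 are represented by their graphs. *)
Definition graph_rel (R : realType) : Type :=
  spinor_field R -> spinor_field R -> Prop.

Definition closure_on_test (R : realType)
    (T : spinor_field R -> spinor_field R) : graph_rel R :=
  fun g h => [/\ inL2 g, inL2 h &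
    exists fs : nat -> spinor_field R,
      [/\ forall n, test_field (fs n), cvgL2 fs g &
          cvgL2 (fun n => T (fs n)) h]].

Definition adjoint (R : realType) (G : graph_rel R) : graph_rel R :=
  fun g h => [/\ inL2 g, inL2 h &
    forall g' h', G g' h' -> dotL2 h' g = dotL2 g' h].

Definition essentially_selfadjoint (R : realType)
    (T : spinor_field R -> spinor_field R) : Prop :=
  forall g h, closure_on_test T g h <-> adjoint (closure_on_test T) g h.

(* [flow_of G U]: U t = e^{itG}, that is, U is a strongly continuous
   one-parameter unitary group with infinitesimal generator iG.
   Preservation of the inner product and the group law give linearity and
   surjectivity of each U t, up to null sets. *)
Definition flow_of (R : realType) (G : graph_rel R)
    (U : R -> spinor_field R -> spinor_field R) : Prop :=
  [/\ forall t f, inL2 f -> inL2 (U t f),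
      forall t f g, inL2 f -> inL2 g -> dotL2 (U t f) (U t g) = dotL2 f g,
      (forall f, inL2 f -> sqL2 (fun x => U 0 f x - f x) = 0%E) /\
      (forall s t f, inL2 f ->
         sqL2 (fun x => U (s + t) f x - U s (U t f) x) = 0%E),
      forall f, inL2 f -> (fun t => sqL2 (fun x => U t f x - f x))
                            @ (0 : R) --> 0%E &
      forall g h, G g h <-> [/\ inL2 g, inL2 h &
        (fun t : R => sqL2 (fun x =>
           (t^-1)%:C *: (U t g x - g x) - imag *: h x)) @ (0 : R)^' --> 0%E]].

(* Fourier transform without normalizing constant, extended from test fields to
   L^2 by density. *)
Definition fourier_test (R : realType) (f : spinor_field R) : spinor_field R :=
  fun xi => \col_a cint3 (fun x =>
    (cos (dotp x xi) -i* sin (dotp x xi)) * f x a 0).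
Definition is_fourier (R : realType) (f fh : spinor_field R) : Prop :=
  [/\ inL2 f, inL2 fh &
    exists fs : nat -> spinor_field R,
      [/\ forall n, test_field (fs n), cvgL2 fs f &
          cvgL2 (fun n => fourier_test (fs n)) fh]].

(* The square of the H^s norm of the field with Fourier transform [fh] *)
Definition sqHs (R : realType) (s : R) (fh : spinor_field R) : \bar R :=
  (\int[leb3 R]_p
     (((1 + enorm (vec3 p) ^+ 2) `^ s) * sqnorm (fh (vec3 p)))%:E)%E.

Definition continuous_Hs (R : realType) (s : R) (v : R -> spinor_field R) :
    Prop :=
  exists vh : R -> spinor_field R,
    (forall t, is_fourier (v t) (vh t) /\ (sqHs s (vh t) < +oo)%E) /\
    (forall t0 : R,
       (fun t => sqHs s (fun xi => vh t xi - vh t0 xi)) @ t0 --> 0%E).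

Definition assumption_A (R : realType) (m : R)
    (A : 'rV[R]_3 -> 'rV[R]_3) : Prop :=
  essentially_selfadjoint (dirac_op m A) /\
  exists2 U, flow_of (closure_on_test (dirac_op m A)) U &
    forall f, test_field f -> continuous_Hs (3%:R / 2%:R) (fun t => U t f).

Definition dirac_solution (R : realType) (m : R) (A : 'rV[R]_3 -> 'rV[R]_3)
    (f : spinor_field R) (u : R -> spinor_field R) : Prop :=
  (forall t x, imag *: time_derivative u t x + dirac_op m A (u t) x = 0) /\
  (forall x, u 0 x = f x).

(* Regularity under which all the integrals, the integrations by parts and the
   differentiation under the integral sign are legitimate. The domination is
   automatic for a C^2 solution u whose support in x is bounded locally uniformly
   in t. *)

Definition weight (R : realType) (A : 'rV[R]_3 -> 'rV[R]_3)
    (phi : 'rV[R]_3 -> R) (x : 'rV[R]_3) : R :=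
  (\sum_(1 <= k < 5) \sum_(s : k.-tuple 'I_3) `|partials s phi x|) *
  (1 + enorm (curl A x) + \sum_i \sum_j `|Dcurl A x i j|).

Definition energy_density (R : realType) (A : 'rV[R]_3 -> 'rV[R]_3)
    (u : R -> spinor_field R) (t : R) (x : 'rV[R]_3) : R :=
  let ut := time_derivative u in
  sqnorm (u t x) + sqnorm (ut t x) + sqnorm (time_derivative ut t x) +
  \sum_k (sqnorm (cov A k (u t) x) + sqnorm (cov A k (ut t) x)).

Definition virial_regular (R : realType) (A : 'rV[R]_3 -> 'rV[R]_3)
    (phi : 'rV[R]_3 -> R) (u : R -> spinor_field R) : Prop :=
  [/\ forall k, Ck 2 (fun x : 'rV[R]_3 => A x 0 k),
      Ck 4 phi,
      forall a, Ck 2 (fun p : R^o * 'rV[R]_3 => Re (u p.1 p.2 a 0)) /\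
                Ck 2 (fun p : R^o * 'rV[R]_3 => Im (u p.1 p.2 a 0)) &
      forall T : R, exists2 G : 'rV[R]_3 -> R, integrable3 G &
        forall t x, `|t| <= T -> weight A phi x * energy_density A u t x <= G x].

(* [V] is the vector field in the magnetic term: V = grad phi /\ B for a general
   multiplier phi. Since grad phi = phi' x/|x| when phi is radial, this is
   V = phi' B_tau in that case. *)

Definition virial_lhs (R : realType) (A : 'rV[R]_3 -> 'rV[R]_3)
    (phi : 'rV[R]_3 -> R) (V : 'rV[R]_3 -> 'rV[R]_3) (v : spinor_field R) :
    R[i] :=
  2%:R * cint3 (fun x => \sum_j \sum_k
           (partial j (partial k phi) x)%:C * hdot (cov A j v x) (cov A k v x))
  - 2%:R^-1 * (int3 (fun x => sqnorm (v x) * laplacian (laplacian phi) x))%:C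
  + 2%:R * (Im (cint3 (fun x => \sum_j
           (V x 0 j)%:C * hdot (v x) (cov A j v x))))%:C
  + 2%:R * cint3 (fun x =>
           hdot (spin_dot (gradient phi x *m (Dcurl A x)^T) *m v x) (v x)).

Definition virial_functional (R : realType) (A : 'rV[R]_3 -> 'rV[R]_3)
    (phi : 'rV[R]_3 -> R) (u : R -> spinor_field R) (t : R) : R :=
  Re (cint3 (fun x =>
    2%:R * (\sum_j (partial j phi x)%:C *
              hdot (time_derivative u t x) (cov A j (u t) x))
    + hdot (time_derivative u t x) (u t x) * (laplacian phi x)%:C)).

Definition virial_identity (R : realType) (A : 'rV[R]_3 -> 'rV[R]_3)
    (phi : 'rV[R]_3 -> R) (V : 'rV[R]_3 -> 'rV[R]_3)
    (u : R -> spinor_field R) : Prop :=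
  forall t : R, derivable (virial_functional A phi u) t 1 /\
    virial_lhs A phi V (u t) = (- derive1 (virial_functional A phi u) t)%:C.

(* Main.v *)
(* A solution of i u_t + H u = 0 satisfies u_tt = - H^2 u, and the anticommutation
   relations give - H^2 = sum_k D_k^2 + 2 S.B - m^2 with D_k = d_k - i A_k. Insert
   this in the time derivative of the density
     Re [u_t . (2 grad phi . conj (D u) + conj u Laplacian phi)],
   and move derivatives around with the product rule
   d_k <v, w> = <D_k v, w> + <v, D_k w> and the commutator
   [D_k, D_j] = - i (d_k A_j - d_j A_k): the result is minus the integrand of the
   left-hand side plus the divergence of an explicit vector field. All these terms
   are dominated by weight * energy_density, although the separate second
   derivatives of u are not; so the divergence integrates to 0 by cutting off the
   whole vector field on boxes, and one may differentiate under the integral. For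
   radial phi, grad phi = phi' x/|x|, so phi' B_tau = grad phi /\ B pointwise. *)

Require Import Defs.
From HB Require Import structures.
From mathcomp Require Import all_boot all_order all_algebra.
From mathcomp Require Import all_classical all_reals all_analysis.
From mathcomp Require Import measurable_realfun.
From mathcomp Require Import complex ring lra.

Set Implicit Arguments.
Unset Strict Implicit.
Unset Printing Implicit Defensive.

Import Order.TTheory GRing.Theory Num.Theory.
Import numFieldNormedType.Exports.

Local Open Scope classical_set_scope.
Local Open Scope ring_scope.
Local Open Scope complex_scope.

(** Time and space form one normed space, and the time derivative is a covariant derivative with
    potential 0. A single commutator lemma then yields both the field strength and the exchange of
    d_t with D_k. Joint C^2 regularity of u is enough: the flux contains no second derivative of u,
    so it is C^1, and u_tt comes from differentiating the equation in time. All pairings are real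
    parts of Hermitian products, which turns the local identity into a polynomial identity between
    real numbers. Each summand of u_tt = sum_k D_k^2 u + 2 S.B u - m^2 u, paired with 2 grad phi . D
    u + u Laplacian phi, has its own fate. The second-order part leaves the Hessian and bi-Laplacian
    terms and, through the commutator, the magnetic one. The pairing with 2 S.B u is the divergence
    of 2 grad phi <S.B u, u> minus the term in which grad phi differentiates B, hence S.(DB grad
    phi). The mass term and the terms in u_t are pure divergences, of - m^2 |u|^2 grad phi and
    |u_t|^2 grad phi, and leave nothing. *)

Local Notation Re := complex.Re.
Local Notation Im := complex.Im.

(** * Iterated directional derivatives *)
Section pointwise_continuity.
Context {R : realType} {T : topologicalType}.
Implicit Types f g : T -> R.

Lemma continuous_add f g : continuous f -> continuous g ->
  continuous (fun x => f x + g x).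
Proof. by move=> cf cg x; exact: (continuousD (cf x) (cg x)). Qed.

Lemma continuous_sub f g : continuous f -> continuous g ->
  continuous (fun x => f x - g x).
Proof. by move=> cf cg x; exact: (continuousB (cf x) (cg x)). Qed.

Lemma continuous_mul f g : continuous f -> continuous g ->
  continuous (fun x => f x * g x).
Proof. by move=> cf cg x; exact: (continuousM (cf x) (cg x)). Qed.

Lemma continuous_const (c : R) : continuous (fun _ : T => c).
Proof. exact: cst_continuous. Qed.

Lemma continuous_scale (c : R) f : continuous f -> continuous (fun x => c * f x).
Proof. by apply: continuous_mul; exact: continuous_const. Qed.

Lemma continuous_bigsum I (r : seq I) (P : pred I) (F : I -> T -> R) :
  (forall i, continuous (F i)) -> continuous (fun x => \sum_(i <- r | P i) F i x).
Proof.
move=> cF; elim: r => [|i r IHr].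
  by under eq_fun do rewrite big_nil; exact: continuous_const.
under eq_fun do rewrite big_cons.
by case: (P i) => //; exact: continuous_add.
Qed.

Lemma continuous_bigprod I (r : seq I) (P : pred I) (F : I -> T -> R) :
  (forall i, continuous (F i)) -> continuous (fun x => \prod_(i <- r | P i) F i x).
Proof.
move=> cF; elim: r => [|i r IHr].
  by under eq_fun do rewrite big_nil; exact: continuous_const.
under eq_fun do rewrite big_cons.
by case: (P i) => //; exact: continuous_mul.
Qed.

End pointwise_continuity.

Section Ck_calculus.
Context {R : realType} {V : normedModType R}.
Implicit Types (f g : V -> R) (x v w : V) (n : nat).

Lemma Ck_continuous n f : Ck n f -> continuous f.
Proof. by case: n => [|n] []. Qed.

Lemma Ck_derivable n f x v : Ck n.+1 f -> derivable f x v.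
Proof. by case=> _ /(_ v)[]. Qed.

Lemma Ck_derive n f v : Ck n.+1 f -> Ck n (fun x => 'D_v f x).
Proof. by case=> _ /(_ v)[]. Qed.

Lemma CkW n f : Ck n.+1 f -> Ck n f.
Proof.
elim: n f => [|n IHn] f [cf df]; split=> // v.
by have [? ?] := df v; split=> //; exact: IHn.
Qed.

Lemma Ck_le n k f : (k <= n)%N -> Ck n f -> Ck k f.
Proof.
move=> /subnK <-; elim: (n - k)%N => [//|j IHj]; rewrite addSn => /CkW.
exact: IHj.
Qed.

Lemma Ck_is_derive n f x v : Ck n.+1 f -> is_derive x v f ('D_v f x).
Proof. by move=> /Ck_derivable h; exact: derivableP. Qed.

Lemma Ck_cst n (c : R) : Ck n (fun _ : V => c).
Proof.
elim: n c => [|n IHn] c; (split; first exact: cst_continuous) => // v.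
split=> [x|]; first exact: derivable_cst.
rewrite (_ : (fun x => 'D_v _ x) = (fun=> 0)) //.
by apply/funext => x; exact: derive_cst.
Qed.

Lemma CkD n f g : Ck n f -> Ck n g -> Ck n (fun x => f x + g x).
Proof.
elim: n f g => [|n IHn] f g [cf df] [cg dg];
  (split; first by move=> x; exact: (continuousD (cf x) (cg x))) => // v.
have [df1 df2] := df v; have [dg1 dg2] := dg v.
split=> [x|]; first exact: (derivableD (df1 x) (dg1 x)).
rewrite (_ : (fun x => 'D_v _ x) = (fun x => 'D_v f x + 'D_v g x)); first exact: IHn.
by apply/funext => x; exact: (deriveD (df1 x) (dg1 x)).
Qed.

Lemma CkM n f g : Ck n f -> Ck n g -> Ck n (fun x => f x * g x).
Proof.
elim: n f g => [|n IHn] f g Cf Cg;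
  have [cf df] := Cf; have [cg dg] := Cg;
  (split; first by move=> x; exact: (continuousM (cf x) (cg x))) => // v.
have [df1 df2] := df v; have [dg1 dg2] := dg v.
split=> [x|]; first exact: (derivableM (df1 x) (dg1 x)).
rewrite (_ : (fun x => 'D_v _ x) = (fun x => f x * 'D_v g x + g x * 'D_v f x)).
  by apply: CkD; apply: IHn => //; exact: CkW.
by apply/funext => x; exact: (deriveM (df1 x) (dg1 x)).
Qed.

Lemma CkZ n (c : R) f : Ck n f -> Ck n (fun x => c * f x).
Proof. by move=> Cf; apply: CkM => //; exact: Ck_cst. Qed.

Lemma CkN n f : Ck n f -> Ck n (fun x => - f x).
Proof.
move=> /(CkZ (-1)); rewrite (_ : (fun x => -1 * f x) = (fun x => - f x)) //.
by apply/funext => x; rewrite mulN1r.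
Qed.

Lemma CkB n f g : Ck n f -> Ck n g -> Ck n (fun x => f x - g x).
Proof. by move=> Cf Cg; apply: CkD => //; exact: CkN. Qed.

Lemma Ck_sum n I (r : seq I) (P : pred I) (F : I -> V -> R) :
  (forall i, Ck n (F i)) -> Ck n (fun x => \sum_(i <- r | P i) F i x).
Proof.
move=> CF; elim: r => [|i r IHr].
  by under eq_fun do rewrite big_nil; exact: Ck_cst.
under eq_fun do rewrite big_cons.
by case: (P i) => //; exact: CkD.
Qed.

Lemma is_derive_mul f g x v (df dg : R) :
  is_derive x v f df -> is_derive x v g dg ->
  is_derive x v (fun y => f y * g y) (df * g x + f x * dg).
Proof.
move=> hf hg; have -> : df * g x + f x * dg = f x *: dg + g x *: df.
  by rewrite /GRing.scale /=; ring.
exact: (is_deriveM hf hg).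
Qed.

Lemma is_derive_mulZ (c : R) f x v (df : R) :
  is_derive x v f df -> is_derive x v (fun y => c * f y) (c * df).
Proof. by move=> hf; exact: (is_deriveZ c hf). Qed.

Lemma is_derive_add f g x v (df dg : R) :
  is_derive x v f df -> is_derive x v g dg ->
  is_derive x v (fun y => f y + g y) (df + dg).
Proof. by move=> hf hg; exact: (is_deriveD hf hg). Qed.

Lemma is_derive_sub f g x v (df dg : R) :
  is_derive x v f df -> is_derive x v g dg ->
  is_derive x v (fun y => f y - g y) (df - dg).
Proof. by move=> hf hg; exact: (is_deriveB hf hg). Qed.

Lemma is_derive_bigsum I (r : seq I) (F : I -> V -> R) x v (dF : I -> R) :
  (forall i, is_derive x v (F i) (dF i)) ->
  is_derive x v (fun y => \sum_(i <- r) F i y) (\sum_(i <- r) dF i).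
Proof.
move=> hF; elim: r => [|i r IHr].
  by under eq_fun do rewrite big_nil; rewrite big_nil; exact: is_derive_cst.
under eq_fun do rewrite big_cons.
by rewrite big_cons; exact: is_derive_add.
Qed.

Lemma is_derive_val f x v (df : R) : is_derive x v f df -> 'D_v f x = df.
Proof. by move=> hf; exact: derive_val. Qed.

(** Along a line, a directional derivative is a derivative in one real variable; this gives access
    to the mean value theorem and the fundamental theorem of calculus. *)
Lemma is_derive_line f (x v : V) (s : R) :
  (forall y, derivable f y v) ->
  is_derive s 1 (fun h : R => f (x + h *: v)) ('D_v f (x + s *: v)).
Proof.
move=> df.
have E : (fun h : R => h^-1 *: (((fun k : R => f (x + k *: v)) \o shift s) (h *: 1)
      - f (x + s *: v))) = (fun h : R => h^-1 *: ((f \o shift (x + s *: v)) (h *: v)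
      - f (x + s *: v))).
  apply/funext => h /=; congr (_ *: (f _ - _)).
  by rewrite scalerDl -[h *: 1]/(h * 1) mulr1 addrCA.
apply: DeriveDef; first by rewrite /derivable E; exact: df.
by rewrite /derive E.
Qed.

Lemma line_MVT f (x v : V) (h : R) :
  (forall y, derivable f y v) -> 0 < h ->
  exists2 s, 0 <= s <= h & f (x + h *: v) - f x = h * 'D_v f (x + s *: v).
Proof.
move=> df h0.
have cf : {within `[0, h], continuous (fun k => f (x + k *: v))}.
  apply: continuous_subspaceT => s; apply: differentiable_continuous.
  by apply/derivable1_diffP; exact: (@ex_derive _ _ _ _ _ _ _ (is_derive_line x s df)).
have [s sI] := @MVT R (fun k => f (x + k *: v)) (fun k => 'D_v f (x + k *: v))
  0 h h0 (fun s _ => is_derive_line x s df) cf.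
rewrite scale0r addr0 subr0 mulrC => E; exists s => //.
by move: sI; rewrite in_itv/= => /andP[/ltW -> /ltW ->].
Qed.

(** The form in which continuity at [x] is applied to the intermediate points that mean value
    theorems produce in the directions [v] and [w]. *)
Lemma near_plane (P : V -> Prop) (x v w : V) : (\near x, P x) ->
  exists2 e : R, 0 < e & forall s t, 0 <= s <= e -> 0 <= t <= e ->
    P (x + s *: v + t *: w).
Proof.
move=> /nbhs_ballP[d /= d0 dP].
(* The summand 1 keeps [c] positive when both directions vanish. *)
set c := `|v| + `|w| + 1.
have c0 : 0 < c by rewrite /c ltr_wpDl// addr_ge0.
exists (d / 2 / c); first by rewrite !divr_gt0.
move=> s t /andP[s0 se] /andP[t0 te]; apply: dP; rewrite -ball_normE /=.
rewrite -addrA opprD addNKr normrN (le_lt_trans (ler_normD _ _))//.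
rewrite !normrZ !ger0_norm//.
have le1 : s * `|v| <= d / 2 / c * `|v| by rewrite ler_wpM2r.
have le2 : t * `|w| <= d / 2 / c * `|w| by rewrite ler_wpM2r.
apply: (le_lt_trans (lerD le1 le2)); rewrite -mulrDr.
have : d / 2 / c * (`|v| + `|w|) <= d / 2 / c * c.
  by rewrite ler_wpM2l ?lerDl// !divr_ge0 ?ltW.
rewrite divfK ?gt_eqF// => /le_lt_trans -> //.
by rewrite ltr_pdivrMr// mulr2n mulrDr mulr1 ltrDl.
Qed.

Lemma continuous_near_dist (g : V -> R) x (e : R) :
  continuous g -> 0 < e -> \forall y \near x, `|g x - g y| < e.
Proof. by move=> /(_ x)/cvgrPdist_lt cg /cg. Qed.

(* Schwarz: both mixed derivatives are values, at points tending to [x], of the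
   same second difference divided by [h ^+ 2]. *)
Lemma Ck_derive_sym f v w x : Ck 2 f ->
  'D_v (fun y => 'D_w f y) x = 'D_w (fun y => 'D_v f y) x.
Proof.
move=> Cf.
(* If [a] and [b] differed, a common value taken near [x] would lie at less than half their distance
   from each of them. *)
set a : R := 'D_v (fun y => 'D_w f y) x; set b : R := 'D_w (fun y => 'D_v f y) x; apply/eqP/negP => /negP ab.
have e0 : 0 < `|a - b| / 2 by rewrite divr_gt0 ?normr_gt0 ?subr_eq0.
have cvw : continuous (fun x => 'D_v (fun y => 'D_w f y) x).
  exact: (Ck_continuous (Ck_derive v (Ck_derive w Cf))).
have cwv : continuous (fun x => 'D_w (fun y => 'D_v f y) x).
  exact: (Ck_continuous (Ck_derive w (Ck_derive v Cf))).
have nvw : \near x, `|a - 'D_v (fun y => 'D_w f y) x| < `|a - b| / 2.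
  exact: (continuous_near_dist x cvw e0).
have nwv : \near x, `|b - 'D_w (fun y => 'D_v f y) x| < `|a - b| / 2.
  exact: (continuous_near_dist x cwv e0).
have [h1 h1_gt0 H1] := near_plane w v nvw.
have [h2 h2_gt0 H2] := near_plane v w nwv.
have [h [h_gt0 hle1 hle2]] : exists h : R, [/\ 0 < h, h <= h1 & h <= h2].
  by exists (Num.min h1 h2); rewrite lt_min h1_gt0 !ge_min !lexx orbT.
clearbody a b.
have incr (y p q : V) : exists2 st : R * R,
    (0 <= st.1 <= h) && (0 <= st.2 <= h) &
    f (y + h *: p + h *: q) - f (y + h *: q) - (f (y + h *: p) - f y) =
    h * (h * 'D_q (fun z => 'D_p f z) (y + st.1 *: p + st.2 *: q)).
  (* Mean value theorem twice: for the increment [g] in direction [p], then for ['D_p f] in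
     direction [q]. *)
  pose g z := f (z + h *: q) - f z.
  have dg z : is_derive z p g ('D_p f (z + h *: q) - 'D_p f z).
    apply: is_derive_sub; last exact: Ck_is_derive Cf.
    have := @Ck_derivable _ _ (z + h *: q) p Cf.
    have E : (fun k : R => k^-1 *: (((fun z => f (z + h *: q)) \o shift z) (k *: p)
        - f (z + h *: q))) = (fun k : R => k^-1 *:
        ((f \o shift (z + h *: q)) (k *: p) - f (z + h *: q))).
      by apply/funext => k /=; rewrite addrA.
    by move=> ?; apply: DeriveDef; rewrite /derivable /derive E.
  have [s sh Es] := line_MVT y (fun z => @ex_derive _ _ _ _ _ _ _ (dg z)) h_gt0.
  have dpq z : derivable (fun z => 'D_p f z) z q.
    by apply: Ck_derivable; exact: Ck_derive Cf.
  have [t th Et] := line_MVT (y + s *: p) dpq h_gt0.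
  exists (s, t); first by rewrite /= sh th.
  by rewrite -Et -(is_derive_val (dg _)) -Es /g; ring.
have [[s t] /= /andP[/andP[s0 sh] /andP[t0 th]] E1] := incr x v w.
have [[s' t'] /= /andP[/andP[s'0 s'h] /andP[t'0 t'h]] E2] := incr x w v.
have {E1 E2} E : 'D_w (fun z => 'D_v f z) (x + s *: v + t *: w) =
                 'D_v (fun z => 'D_w f z) (x + s' *: w + t' *: v).
  have hn : h != 0 by rewrite gt_eqF.
  suff : h * (h * 'D_w (fun z => 'D_v f z) (x + s *: v + t *: w)) =
         h * (h * 'D_v (fun z => 'D_w f z) (x + s' *: w + t' *: v)).
    by move=> /(mulfI hn)/(mulfI hn).
  apply: (etrans (esym E1)); apply: (etrans _ E2).
  rewrite [x + h *: v + h *: w]addrAC.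
  move: (f _) (f (x + h *: w)) (f (x + h *: v)) (f x) => a1 a2 a3 a4.
  by rewrite !opprB; ring.
have K2 : `|b - 'D_v (fun z => 'D_w f z) (x + s' *: w + t' *: v)| < `|a - b| / 2.
  rewrite -E; apply: H2; rewrite ?s0 ?t0 /=; first exact: le_trans hle2.
  exact: le_trans hle2.
have K1 : `|a - 'D_v (fun z => 'D_w f z) (x + s' *: w + t' *: v)| < `|a - b| / 2.
  apply: H1; rewrite ?s'0 ?t'0 /=; first exact: le_trans hle1.
  exact: le_trans hle1.
suff : `|a - b| < `|a - b| by rewrite ltxx.
rewrite [ltRHS]splitr; apply: le_lt_trans (ltrD K1 K2).
move: K1 K2; move: ('D_v _ (_ + _ + _)) => y K1 K2.
by rewrite [`|b - y|]distrC; exact: ler_distD.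
Qed.

(** [Ck] speaks of directional derivatives only, so linearity in the direction has to be earned. The
    increment along [h *: (v + w)] is one along [h *: v] followed by one along [h *: w]; the mean
    value theorem on the three segments and continuity of the three derivatives at [x] conclude. *)
Lemma Ck_deriveD_dir f v w x : Ck 1 f -> 'D_(v + w) f x = 'D_v f x + 'D_w f x.
Proof.
move=> Cf.
have df p y : derivable f y p by exact: Ck_derivable Cf.
have near_D p (e : R) : 0 < e -> exists2 d : R, 0 < d &
    forall s t, 0 <= s <= d -> 0 <= t <= d ->
    `|'D_p f x - 'D_p f (x + s *: v + t *: w)| < e.
  move=> e0.
  have near_x := continuous_near_dist x (Ck_continuous (Ck_derive p Cf)) e0.
  exact: (near_plane v w near_x).
apply/eqP; rewrite -subr_eq0 -normr_le0; apply/ler_addgt0Pr => e e0.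
have e3 : 0 < e / 3 by rewrite divr_gt0.
have [d1 d1_gt0 H1] := near_D (v + w) _ e3.
have [d2 d2_gt0 H2] := near_D v _ e3.
have [d3 d3_gt0 H3] := near_D w _ e3.
have [h [h_gt0 hd1 hd2 hd3]] :
    exists h : R, [/\ 0 < h, h <= d1, h <= d2 & h <= d3].
  exists (Num.min d1 (Num.min d2 d3)).
  by rewrite !lt_min d1_gt0 d2_gt0 !ge_min !lexx !orbT.
have [s /andP[s0 sh] Es] := line_MVT x (df (v + w)) h_gt0.
have [r /andP[r0 rh] Er] := line_MVT x (df v) h_gt0.
(* The second segment starts where the first one ends. *)
have [t /andP[t0 th] Et] := line_MVT (x + h *: v) (df w) h_gt0.
have {H1} := H1 s s; rewrite s0 (le_trans sh hd1) => /(_ isT isT).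
have {H2} := H2 r 0; rewrite r0 (le_trans rh hd2) lexx ltW// => /(_ isT isT).
have {H3} := H3 h t; rewrite t0 (le_trans th hd3) ltW// hd3 => /(_ isT isT).
rewrite scale0r addr0 -(addrA x (s *: v)) -(scalerDr s v).
have : 'D_(v + w) f (x + s *: (v + w)) =
       'D_w f (x + h *: v + t *: w) + 'D_v f (x + r *: v).
  apply: (@mulfI _ h); first by rewrite gt_eqF.
  rewrite mulrDr; apply: (etrans (esym Es)).
  apply: (etrans _ (congr2 +%R Et Er)).
  by rewrite scalerDr addrA addrA subrK.
move: ('D_(v + w) f _) ('D_w f (x + h *: v + _)) ('D_v f (x + r *: v)).
move: ('D_(v + w) f x) ('D_v f x) ('D_w f x) => a b c p q y -> H3 H2 H1.
rewrite add0r (_ : _ - _ = (a - (q + y)) - (c - q) - (b - y)); last by ring.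
rewrite (_ : e = e / 3 + e / 3 + e / 3); last by field.
apply: le_trans (ler_normB _ _) _; apply: lerD; last exact: ltW.
by apply: le_trans (ler_normB _ _) _; apply: lerD; exact: ltW.
Qed.

End Ck_calculus.

(** * Divergence theorem on R^3 *)
Section joint_measurability.
Context {R : realType}.

Lemma continuous_pairl (T U : topologicalType) (y : U) :
  continuous (fun x : T => (x, y)).
Proof. by move=> x; apply: cvg_pair; [exact: cvg_id|exact: cvg_cst]. Qed.

Lemma continuous_pairr (T U : topologicalType) (x : T) :
  continuous (fun y : U => (x, y)).
Proof. by move=> y; apply: cvg_pair; [exact: cvg_cst|exact: cvg_id]. Qed.

Definition step_approx (n : nat) (y : R) : R :=
  (Num.floor (y * n.+1%:R))%:~R / n.+1%:R.

Lemma cvg_step_approx (y : R) : step_approx n y @[n --> \oo] --> y.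
Proof.
apply/cvgrPdist_le => e e0.
have : (n.+1%:R^-1 : R) @[n --> \oo] --> (0 : R) by exact: cvg_harmonic.
move=> /cvgrPdist_le/(_ _ e0); apply: filterS => n.
rewrite sub0r normrN ger0_norm ?invr_ge0//; apply: le_trans.
have n0 : 0 < n.+1%:R :> R by [].
have /andP[l u] := floor_itv (y * n.+1%:R).
rewrite /step_approx ger0_norm.
  rewrite lerBlDr -[X in X + _]mul1r -mulrDl ler_pdivlMr// addrC.
  by rewrite (le_trans (ltW u))// intrD.
by rewrite subr_ge0 ler_pdivrMr.
Qed.

(* A function measurable in its first argument and continuous in the second
   (a Caratheodory function) is the limit of its values at [step_approx n y],
   which are measurable as countable unions of rectangles. *)
Lemma measurable_caratheodory d (T : measurableType d) (f : T * R -> R) :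
  (forall y, measurable_fun setT (fun x => f (x, y))) ->
  (forall x, continuous (fun y => f (x, y))) ->
  measurable_fun setT f.
Proof.
move=> mf cf.
apply: (@measurable_fun_cvg _ _ _ setT (fun n p => f (p.1, step_approx n p.2))).
- move=> n _ Y mY; rewrite setTI.
  pose grid (k : int) : R := k%:~R / n.+1%:R.
  rewrite (_ : _ @^-1` Y = \bigcup_(k in [set: int])
    ([set x | Y (f (x, grid k))] `*`
     [set y | Num.floor (y * n.+1%:R) = k])); last first.
    apply/seteqP; split => [[x y] /= Yf|[x y] [k _ [/= Yf yk]]].
      by exists (Num.floor (y * n.+1%:R)).
    by rewrite /step_approx yk.
  apply: countable_bigcupT_measurable => [|k]; first exact: countableP.
  apply: measurableX; first by rewrite -[X in measurable X]setTI; exact: mf.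
  rewrite (_ : [set y | _] = ( *%R^~ n.+1%:R) @^-1` `[k%:~R, (k + 1)%:~R[); last first.
    apply/seteqP; split=> y /=; rewrite in_itv/=.
      by move=> <-; exact: floor_itv.
    by move=> h; apply: floor_def.
  rewrite -[X in measurable X]setTI.
  have mM : measurable_fun [set: R] ( *%R^~ n.+1%:R) by exact: mulrr_measurable.
  exact: mM.
- move=> [x y] _ /=.
  by apply: (continuous_cvg _ (cf x y)); exact: cvg_step_approx.
Qed.

Lemma continuous_measurable2 (f : R * R -> R) :
  continuous f -> measurable_fun setT f.
Proof.
move=> cf; apply: measurable_caratheodory => [y|x].
  apply: continuous_measurable_fun => x.
  by apply: (@continuous_comp _ _ _ (fun x => (x, y)) f);
    [exact: continuous_pairl|exact: cf].
move=> y.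
by apply: (@continuous_comp _ _ _ (fun y => (x, y)) f);
  [exact: continuous_pairr|exact: cf].
Qed.

Lemma continuous_measurable3 (f : R * R * R -> R) :
  continuous f -> measurable_fun setT f.
Proof.
move=> cf; apply: measurable_caratheodory => [y|x].
  apply: continuous_measurable2 => x.
  by apply: (@continuous_comp _ _ _ (fun x => (x, y)) f);
    [exact: continuous_pairl|exact: cf].
move=> y.
by apply: (@continuous_comp _ _ _ (fun y => (x, y)) f);
  [exact: continuous_pairr|exact: cf].
Qed.

Lemma continuous_row3 (T : topologicalType) (g : 'I_3 -> T -> R) :
  (forall k, continuous (g k)) -> continuous (fun p => \row_(k < 3) g k p).
Proof.
move=> cg p; apply/cvg_mx_entourageP => E entE.
have cgE k : \forall q \near p, (g k p, g k q) \in E.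
  have nE : nbhs p (g k @^-1` [set y | E (g k p, y)]).
    by have /cvg_entourageP/(_ _ entE) := cg k p.
  by apply: filterS nE => q; rewrite inE.
have allE : nbhs p [set q | forall k, (g k p, g k q) \in E].
  exact: (@filter_forall _ _ (fun k q => (g k p, g k q) \in E) (nbhs p) _ cgE).
by apply: filterS allE => q qE i j; rewrite !mxE; exact: qE.
Qed.

Lemma continuous_vec3 : continuous (@vec3 R).
Proof.
apply: continuous_row3 => -[[|[|[|]]]//= _] p.
- by apply: (@continuous_comp _ _ _ fst fst); exact: cvg_fst.
- by apply: (@continuous_comp _ _ _ fst snd); [exact: cvg_fst|exact: cvg_snd].
- exact: cvg_snd.
Qed.

End joint_measurability.

Section plane_measure.
Context {R : realType}.
Local Notation leb := (@lebesgue_measure R).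

(* An alias: on [product_measure1] the library's sigma-finiteness instance is
   shadowed by the one for products of subprobabilities. *)
Definition leb2 := (leb \x leb)%E.

HB.instance Definition _ := Measure.copy leb2 (leb \x leb)%E.

Let leb2_sigma_finite : sigma_finite setT leb2.
Proof.
exists (fun n : nat => `[- n%:R, n%:R]%classic `*` `[- n%:R, n%:R]%classic).
  apply/esym/seteqP; split=> // -[x y] _.
  exists (Num.bound (`|x| + `|y|)) => //=; rewrite !in_itv/= -!ler_norml.
  have := archi_boundP (addr_ge0 (normr_ge0 x) (normr_ge0 y)).
  by move=> /ltW xy; split; apply: le_trans xy; rewrite ?lerDl ?lerDr.
move=> n; split; first by apply: measurableX; exact: measurable_itv.
have lebn : (leb `[(- n%:R)%R, n%:R] < +oo)%E.
  by apply: compact_finite_measure; exact: segment_compact.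
rewrite /leb2 product_measure1E; [|exact: measurable_itv|exact: measurable_itv].
by rewrite lte_mul_pinfty// ge0_fin_numE.
Qed.

HB.instance Definition _ :=
  Measure_isSigmaFinite.Build _ _ _ leb2 leb2_sigma_finite.

End plane_measure.

Section box_integrals.
Context {R : realType}.
Local Notation leb := (@lebesgue_measure R).

Section vanishing.
Context d1 d2 (T1 : measurableType d1) (T2 : measurableType d2).
Variables (m1 : {sigma_finite_measure set T1 -> \bar R})
  (m2 : {sigma_finite_measure set T2 -> \bar R}) (D1 : set T1) (D2 : set T2).
Hypotheses (mD1 : measurable D1) (mD2 : measurable D2).
Variable f : T1 * T2 -> \bar R.
Hypothesis intf : (m1 \x m2)%E.-integrable (D1 `*` D2) f.

Let intfD : (m1 \x m2)%E.-integrable setT (f \_ (D1 `*` D2)).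
Proof. by apply/(integrable_mkcond _ _).1 => //; exact: measurableX. Qed.

Lemma integral_setX_eq0r :
  (forall x, \int[m2]_(y in D2) f (x, y) = 0)%E ->
  (\int[m1 \x m2]_(p in D1 `*` D2) f p = 0)%E.
Proof.
move=> f0; rewrite integral_mkcond -integral12_prod_meas1//.
apply: integral0_eq => x _ /=.
have [xD|xD] := pselect (D1 x).
  rewrite -[RHS](f0 x) [RHS]integral_mkcond; apply: eq_integral => y _.
  rewrite !patchE; congr (if _ then _ else _).
  by apply/idP/idP; rewrite !inE => // -[].
apply: integral0_eq => y _; rewrite patchE memNset//.
by move=> [].
Qed.

Lemma integral_setX_eq0l :
  (forall y, \int[m1]_(x in D1) f (x, y) = 0)%E ->
  (\int[m1 \x m2]_(p in D1 `*` D2) f p = 0)%E.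
Proof.
move=> f0; rewrite integral_mkcond -integral21_prod_meas1//.
apply: integral0_eq => y _ /=.
have [yD|yD] := pselect (D2 y).
  rewrite -[RHS](f0 y) [RHS]integral_mkcond; apply: eq_integral => x _.
  rewrite !patchE; congr (if _ then _ else _).
  by apply/idP/idP; rewrite !inE => // -[].
apply: integral0_eq => x _; rewrite patchE memNset//.
by move=> [].
Qed.

End vanishing.

Variable n : R.
Let I : set R := `[- n, n]%classic.
Let mI : measurable I. Proof. exact: measurable_itv. Qed.

Let compI : compact I. Proof. exact: segment_compact. Qed.

Local Notation leb2 := (@leb2 R).

Let Ifin : (leb I < +oo)%E.
Proof. exact: compact_finite_measure. Qed.

Let I2fin : (leb2 (I `*` I) < +oo)%E.
Proof. by rewrite /leb2 product_measure1E//= lte_mul_pinfty// ge0_fin_numE. Qed.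

Let I3fin : (leb3 R (I `*` I `*` I) < +oo)%E.
Proof.
rewrite /leb3 product_measure1E//=; last exact: measurableX.
by rewrite lte_mul_pinfty// ge0_fin_numE.
Qed.

Lemma continuous_compact_bounded (T : topologicalType) (A : set T) (f : T -> R) :
  continuous f -> compact A -> [bounded f x | x in A].
Proof.
move=> cf cA; have := @compact_bounded R R^o (f @` A).
move=> /(_ (continuous_compact (continuous_subspaceT cf) cA)).
move=> [M [Mreal HM]]; exists M; split=> // r Mr x Ax.
by apply: (HM r Mr); exists x.
Qed.

Lemma continuous_integrable_box2 (f : R * R -> R) : continuous f ->
  leb2.-integrable (I `*` I) (EFin \o f).
Proof.
move=> cf; apply: measurable_bounded_integrable => //.
- exact: measurableX.
- by apply: measurable_funTS; exact: continuous_measurable2.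
- exact: (continuous_compact_bounded cf (compact_setX compI compI)).
Qed.

Lemma continuous_integrable_box3 (f : R * R * R -> R) : continuous f ->
  (leb3 R).-integrable (I `*` I `*` I) (EFin \o f).
Proof.
move=> cf; apply: measurable_bounded_integrable => //.
- by apply: measurableX => //; exact: measurableX.
- by apply: measurable_funTS; exact: continuous_measurable3.
- exact: (continuous_compact_bounded cf (compact_setX (compact_setX compI compI) compI)).
Qed.

(** Fubini with coordinate [k] integrated before the remaining ones: points [b] with [b 0 k = 0]
    parametrize the lines parallel to that axis. The three cases follow the nesting of the product
    measure. *)
Lemma integral_box_eq0 (h : 'rV[R]_3 -> R) (k : 'I_3) : continuous h ->
  (forall b : 'rV[R]_3, b 0 k = 0 ->
    (\int[leb]_(s in I) (h (b + s *: delta_mx 0 k)%R)%:E = 0)%E) ->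
  (\int[leb3 R]_(p in I `*` I `*` I) (h (vec3 p))%:E = 0)%E.
Proof.
move=> ch h0.
have mI2 : measurable (I `*` I) by exact: measurableX.
have cv : continuous (h \o @vec3 R).
  by move=> p; apply: continuous_comp; [exact: continuous_vec3|exact: ch].
have int3h := continuous_integrable_box3 cv.
have cz z : continuous (fun p => h (vec3 (p, z))).
  move=> p; apply: (@continuous_comp _ _ _ (fun p : R * R => (p, z)) (h \o @vec3 R)).
    exact: continuous_pairl.
  exact: cv.
case: k h0 => -[|[|[|//]]] /= kI h0.
- apply: (@integral_setX_eq0l _ _ _ _ leb2 leb (I `*` I) I
    mI2 mI (fun p => (h (vec3 p))%:E) int3h) => z.
  apply: (@integral_setX_eq0l _ _ _ _ leb leb I I mI mI
    (fun p => (h (vec3 (p, z)))%:E)) => [|y].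
    exact: continuous_integrable_box2 (cz z).
  rewrite -[RHS](h0 (vec3 (0, y, z))) ?mxE//; apply: eq_integral => s _ /=.
  congr (h _)%:E; apply/rowP => -[[|[|[|]]]//= j]; rewrite !mxE/=.
  + by rewrite mulr1 add0r.
  + by rewrite mulr0 addr0.
  + by rewrite mulr0 addr0.
- apply: (@integral_setX_eq0l _ _ _ _ leb2 leb (I `*` I) I
    mI2 mI (fun p => (h (vec3 p))%:E) int3h) => z.
  apply: (@integral_setX_eq0r _ _ _ _ leb leb I I mI mI
    (fun p => (h (vec3 (p, z)))%:E)) => [|x].
    exact: continuous_integrable_box2 (cz z).
  rewrite -[RHS](h0 (vec3 (x, 0, z))) ?mxE//; apply: eq_integral => s _ /=.
  congr (h _)%:E; apply/rowP => -[[|[|[|]]]//= j]; rewrite !mxE/=.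
  + by rewrite mulr0 addr0.
  + by rewrite mulr1 add0r.
  + by rewrite mulr0 addr0.
- apply: (@integral_setX_eq0r _ _ _ _ leb2 leb (I `*` I) I
    mI2 mI (fun p => (h (vec3 p))%:E) int3h) => -[x y].
  rewrite -[RHS](h0 (vec3 (x, y, 0))) ?mxE//; apply: eq_integral => s _ /=.
  congr (h _)%:E; apply/rowP => -[[|[|[|]]]//= j]; rewrite !mxE/=.
  + by rewrite mulr0 addr0.
  + by rewrite mulr0 addr0.
  + by rewrite mulr1 add0r.
Qed.

(** The fundamental theorem of calculus on each segment parallel to axis [k]: its end points lie on
    the faces where [Y] vanishes. *)
Lemma integral_partial_box_eq0 (Y : 'rV[R]_3 -> R) (k : 'I_3) : 0 < n ->
  (forall x, derivable Y x (delta_mx 0 k)) -> continuous (partial k Y) ->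
  (forall x : 'rV[R]_3, `|x 0 k| = n -> Y x = 0) ->
  (\int[leb3 R]_(p in I `*` I `*` I) (partial k Y (vec3 p))%:E = 0)%E.
Proof.
move=> n0 dY cY Yn; apply: (@integral_box_eq0 _ k) => // b bk.
have Y0 (s : R) : `|s| = n -> Y (b + s *: delta_mx 0 k) = 0.
  by move=> sn; apply: Yn; rewrite !mxE !eqxx bk add0r mulr1.
have dl (s : R) := is_derive_line b s dY.
have cl : continuous (fun s : R => Y (b + s *: delta_mx 0 k)).
  move=> s; apply: differentiable_continuous; apply/derivable1_diffP.
  exact: (@ex_derive _ _ _ _ _ _ _ (dl s)).
have clin : continuous (fun s : R => b + s *: delta_mx 0 k : 'rV[R]_3).
  move=> s; apply: cvgD; first exact: cvg_cst.
  exact: scalel_continuous.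
rewrite (@continuous_FTC2 _ _ (fun s => Y (b + s *: delta_mx 0 k))).
- by rewrite !Y0 ?normrN ?gtr0_norm// -EFinB subrr.
- by rewrite gtrN.
- apply: continuous_subspaceT => s.
  by apply: (continuous_comp (clin s)); exact: cY.
- split.
  + by move=> s _; exact: (@ex_derive _ _ _ _ _ _ _ (dl s)).
  + by apply: cvg_at_right_filter; exact: cl.
  + by apply: cvg_at_left_filter; exact: cl.
- by move=> s _; rewrite derive1E; exact: derive_val.
Qed.

End box_integrals.

(** * Cut-off functions and the divergence theorem for integrable fields *)

Section divergence_theorem.
Context {R : realType}.

Lemma is_derive_affine (V : normedModType R) (f : V -> R) (x v : V) (c : R) :
  (forall h, f (h *: v + x) = h * c + f x) -> is_derive x v f c.
Proof.
move=> fE.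
have lim_c : h^-1 *: ((f \o shift x) (h *: v) - f x) @[h --> 0^'] --> c.
  apply: cvg_near_cst; near=> h.
  rewrite /= fE addrK /GRing.scale/= mulrA mulVf ?mul1r//.
  by near: h; exact: nbhs_dnbhs_neq.
apply: DeriveDef; first by apply/cvg_ex; exists c.
by apply/cvg_lim => //; exact: Rhausdorff.
Unshelve. all: by end_near. Qed.

(* [cutoff n] vanishes on the faces of the box of half-width n and tends to 1,
   its derivatives are O(1/n) there: truncation by it leaves no boundary term. *)
Definition cutoff (n : R) (x : 'rV[R]_3) : R :=
  \prod_(k < 3) (1 - (x 0 k / n) ^+ 2).

Definition cutoff_partial (n : R) (k : 'I_3) (x : 'rV[R]_3) : R :=
  - (2 * x 0 k / n ^+ 2) * \prod_(j < 3 | j != k) (1 - (x 0 j / n) ^+ 2).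

Lemma is_derive_cutoff n k x :
  is_derive x (delta_mx 0 k) (cutoff n) (cutoff_partial n k x).
Proof.
pose q (y : 'rV[R]_3) := \prod_(j < 3 | j != k) (1 - (y 0 j / n) ^+ 2).
have dq : is_derive x (delta_mx 0 k) q 0.
  apply: is_derive_affine => h; rewrite mulr0 add0r; apply: eq_bigr => j jk.
  by rewrite !mxE (negbTE jk) andbF mulr0 add0r.
have dx : is_derive x (delta_mx 0 k) (fun y : 'rV[R]_3 => y 0 k) 1.
  by apply: is_derive_affine => h; rewrite !mxE !eqxx.
have dn : is_derive x (delta_mx 0 k) (fun y : 'rV[R]_3 => 1 - (n ^+ 2)^-1 * (y 0 k * y 0 k))
    (0 - (n ^+ 2)^-1 * (1 * x 0 k + x 0 k * 1)).
  apply: is_derive_sub.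
  by apply: is_derive_mulZ; exact: is_derive_mul.
rewrite (_ : cutoff n = fun y => (1 - (n ^+ 2)^-1 * (y 0 k * y 0 k)) * q y).
  have d := is_derive_mul dn dq; apply: (is_derive_eq d).
  by rewrite /cutoff_partial -/(q x); ring.
by apply/funext => y; rewrite /cutoff (bigD1 k)//= expr_div_n; congr ((1 - _) * _); ring.
Qed.

Lemma continuous_coord (k : 'I_3) : continuous (fun x : 'rV[R]_3 => x 0 k).
Proof. exact: coord_continuous. Qed.

Lemma continuous_bump n k : continuous (fun x : 'rV[R]_3 => 1 - (x 0 k / n) ^+ 2).
Proof.
have cn : continuous (fun x : 'rV[R]_3 => x 0 k / n).
  by apply: continuous_mul; [exact: continuous_coord|exact: continuous_const].
by apply: continuous_sub; [exact: continuous_const|exact: continuous_mul].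
Qed.

Lemma continuous_cutoff n : continuous (cutoff n).
Proof. by apply: continuous_bigprod => k; exact: continuous_bump. Qed.

Lemma continuous_cutoff_partial n k : continuous (cutoff_partial n k).
Proof.
apply: continuous_mul; last first.
  by apply: continuous_bigprod => j; exact: continuous_bump.
have c2 : continuous (fun x : 'rV[R]_3 => 2 * x 0 k / n ^+ 2).
  apply: continuous_mul; last exact: continuous_const.
  by apply: continuous_scale; exact: continuous_coord.
by move=> x; exact: (continuousN (c2 x)).
Qed.

Lemma bump_bound (n s : R) : `|s| <= n -> 0 <= 1 - (s / n) ^+ 2 <= 1.
Proof.
move=> sn; rewrite subr_ge0 lerBlDr lerDl sqr_ge0 andbT.
rewrite -real_normK ?num_real// expr_le1// normrM normfV.
(* Division by 0 gives 0, so the bound also holds for the degenerate box. *)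
have [->|n0] := eqVneq n 0; first by rewrite normr0 invr0 mulr0.
by rewrite ler_pdivrMr ?normr_gt0// mul1r (le_trans sn)// ler_norm.
Qed.

Lemma prod_bump_bound (n : R) (P : pred 'I_3) (x : 'rV[R]_3) :
  (forall k, `|x 0 k| <= n) ->
  0 <= \prod_(k < 3 | P k) (1 - (x 0 k / n) ^+ 2) <= 1.
Proof.
move=> xn; apply/andP; split.
  by apply: prodr_ge0 => k _; have /andP[] := bump_bound (xn k).
by apply: prodr_ile1 => k _; exact: bump_bound.
Qed.

End divergence_theorem.

Section divergence_theorem_proof.
Context {R : realType}.
Variable X : 'I_3 -> 'rV[R]_3 -> R.
Hypotheses (cX : forall k, continuous (X k))
  (dX : forall k x, derivable (X k) x (delta_mx 0 k))
  (cdX : forall k, continuous (partial k (X k)))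
  (intX : forall k, integrable3 (X k)).
Let divX x := \sum_k partial k (X k) x.
Hypothesis int_divX : integrable3 divX.

Let Y n k x := cutoff n x * X k x.

Let dY n k x : is_derive x (delta_mx 0 k) (Y n k)
  (cutoff_partial n k x * X k x + cutoff n x * partial k (X k) x).
Proof.
by apply: is_derive_mul; [exact: is_derive_cutoff|exact: derivableP].
Qed.

Let partialY n k : partial k (Y n k) =
  fun x => cutoff_partial n k x * X k x + cutoff n x * partial k (X k) x.
Proof. by apply/funext => x; exact: (is_derive_val (dY n k x)). Qed.

Let c_partialY n k : continuous (partial k (Y n k)).
Proof.
rewrite partialY; apply: continuous_add; apply: continuous_mul => //.
  exact: continuous_cutoff_partial.
exact: continuous_cutoff.
Qed.

Let Y0 (n : R) k (x : 'rV[R]_3) : 0 < n -> `|x 0 k| = n -> Y n k x = 0.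
Proof.
move=> n0 xn; rewrite /Y /cutoff (bigD1 k)//= -real_normK ?num_real//.
by rewrite normrM normfV xn gtr0_norm// divff ?gt_eqF// expr1n subrr !mul0r.
Qed.

Let box (n : R) : set (R * R * R) :=
  `[- n, n]%classic `*` `[- n, n]%classic `*` `[- n, n]%classic.

Let mbox n : measurable (box n).
Proof.
by apply: measurableX; [apply: measurableX|]; exact: measurable_itv.
Qed.

Let inbox n p : box n p <-> forall k, `|vec3 p 0 k| <= n.
Proof.
case: p => -[x y] z; split => /=; rewrite /box/= !in_itv/= -!ler_norml.
  by move=> [[xn yn] zn] [[|[|[|]]]//= j]; rewrite mxE.
move=> H; have := H ord0; have := H (Ordinal (isT : (1 < 3)%N)).
by have := H ord_max; rewrite !mxE.
Qed.

Let h n x := \sum_k partial k (Y n k) x.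

Let ch n : continuous (h n).
Proof. by apply: continuous_bigsum => k; exact: c_partialY. Qed.

Let int_h n : 0 < n -> (\int[leb3 R]_(p in box n) (h n (vec3 p))%:E = 0)%E.
Proof.
move=> n0; under eq_integral do rewrite /h -sumEFin.
have int_k k : (leb3 R).-integrable (box n) (fun p => (partial k (Y n k) (vec3 p))%:E).
  have c3 : continuous (partial k (Y n k) \o @vec3 R).
    move=> p; apply: continuous_comp; first exact: continuous_vec3.
    exact: c_partialY.
  exact: (@continuous_integrable_box3 R n _ c3).
rewrite integral_sum; [|exact: mbox|exact: int_k].
rewrite big1 => [//|k _]; apply: integral_partial_box_eq0 => // [x|x xn].
- exact: (@ex_derive _ _ _ _ _ _ _ (dY n k x)).
- exact: Y0.
Qed.

Let hE n x : h n x = cutoff n x * divX x + \sum_k cutoff_partial n k x * X k x.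
Proof.
rewrite /h /divX big_distrr -big_split/=; apply: eq_bigr => k _.
by rewrite partialY addrC.
Qed.

(** A bound independent of [n], for dominated convergence. On the box [|x_k| <= n <= n ^+ 2], whence
    the factor 2 on [X k]; the decay of the derivatives of the cut-off matters only for the
    pointwise limit. Derivatives of [X] enter through [divX] alone. *)
Let h_bound (n : R) (x : 'rV[R]_3) : 1 <= n -> (forall k, `|x 0 k| <= n) ->
  `|h n x| <= `|divX x| + \sum_k 2 * `|X k x|.
Proof.
move=> n1 xn; rewrite hE (le_trans (ler_normD _ _))//; apply: lerD.
  rewrite normrM ler_piMl//.
  have /andP[c0 c1] := prod_bump_bound xpredT xn.
  by rewrite ger0_norm.
apply: (le_trans (ler_norm_sum _ _ _)); apply: ler_sum => k _.
rewrite normrM ler_wpM2r// /cutoff_partial normrM normrN.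
have n0 : 0 < n by rewrite (lt_le_trans ltr01).
have /andP[c0 c1] := prod_bump_bound (fun j => j != k) xn.
rewrite [X in _ * X]ger0_norm// -[leRHS]mulr1 ler_pM//.
rewrite !normrM normfV normrX (gtr0_norm n0) (@ger0_norm _ 2)//.
rewrite ler_pdivrMr ?exprn_gt0// ler_wpM2l//.
by rewrite (le_trans (xn k))// expr2 ler_peMl// ltW.
Qed.

Let h_cvg p : (fun n : nat => h n.+1%:R (vec3 p)) @ \oo --> divX (vec3 p).
Proof.
move: (vec3 p) => x.
(* [h] at a fixed point as a polynomial in [s = 1 / n]: the limit is its value at 0, where only
   [divX] survives. *)
pose H (s : R) := (\prod_(k < 3) (1 - (x 0 k * s) ^+ 2)) * divX x +
  \sum_k (-2 * x 0 k * s ^+ 2) * (\prod_(j < 3 | j != k) (1 - (x 0 j * s) ^+ 2)) * X k x.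
have cs : continuous (fun s : R => s) by move=> s; exact: cvg_id.
have cb (c : R) : continuous (fun s : R => 1 - (c * s) ^+ 2).
  apply: continuous_sub; first exact: continuous_const.
  by apply: continuous_mul; apply: continuous_scale.
have cH : continuous H.
  apply: continuous_add.
    apply: continuous_mul; last exact: continuous_const.
    by apply: continuous_bigprod => k; exact: cb.
  apply: continuous_bigsum => k; apply: continuous_mul; last exact: continuous_const.
  apply: continuous_mul; last by apply: continuous_bigprod => j; exact: cb.
  by apply: continuous_scale; exact: continuous_mul.
have H0 : H 0 = divX x.
  rewrite /H big1 ?mul1r => [|k _]; last by rewrite mulr0 expr0n subr0.
  by rewrite big1 ?addr0// => k _; rewrite expr0n !mulr0 !mul0r.
have hH n : h n.+1%:R x = H n.+1%:R^-1.
  rewrite hE /H /cutoff; congr (_ + _); apply: eq_bigr => k _.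
  by rewrite /cutoff_partial exprVn -!mulNr.
under eq_fun do rewrite hH.
rewrite -H0; apply: (continuous_cvg _ (cH 0)); exact: cvg_harmonic.
Qed.

Theorem int3_divergence_eq0 : int3 divX = 0.
Proof.
(* The shift to [n.+1] makes the half-width at least 1, as [h_bound] requires. Restriction to the
   box makes all these functions live on the same domain. *)
pose f_ (n : nat) := (fun p => (h n.+1%:R (vec3 p))%:E) \_ (box n.+1%:R).
pose g p := (`|divX (vec3 p)| + \sum_k 2 * `|X k (vec3 p)|)%:E.
have mf n : @measurable_fun _ _
    (measurableTypeR R * measurableTypeR R * measurableTypeR R)%type _ setT (f_ n).
  have mh : measurable_fun setT (fun p => (h n.+1%:R (vec3 p))%:E).
    apply/measurable_EFinP; apply: continuous_measurable3 => p.
    by apply: continuous_comp; [exact: continuous_vec3|exact: ch].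
  apply: (measurable_restrictT _ (mbox _)).1; exact: measurable_funTS mh.
have ig : (leb3 R).-integrable setT g.
  rewrite (_ : g = fun p => (`|(divX (vec3 p))%:E| +
      \sum_k 2%:E * `|(X k (vec3 p))%:E|)%E).
    apply: integrableD => //; first exact: integrable_abse.
    apply: integrable_sum => // k _; apply: integrableZl => //.
    exact/integrable_abse/intX.
  apply/funext => p; rewrite /g EFinD -sumEFin abse_EFin; congr (_ + _)%E.
have fcvg p : f_ ^~ p @ \oo --> (divX (vec3 p))%:E.
  have hE_cvg : (fun n : nat => (h n.+1%:R (vec3 p))%:E) @ \oo --> (divX (vec3 p))%:E.
    apply/fine_cvgP; split; [exact: nearW|exact: h_cvg].
  apply: cvg_trans hE_cvg; apply: near_eq_cvg.
  (* A fixed point lies in every box whose half-width exceeds the sum of the absolute values of its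
     coordinates. *)
  exists (Num.bound (\sum_k `|vec3 p 0 k|)) => // n /= nb.
  rewrite /f_ patchE mem_set//; apply/inbox => k.
  apply: (@le_trans _ _ (\sum_k `|vec3 p 0 k|)).
    by rewrite (bigD1 k)//= lerDl sumr_ge0.
  have s0 : 0 <= \sum_k `|vec3 p 0 k| by exact: sumr_ge0.
  by apply: (le_trans (ltW (archi_boundP s0))); rewrite ler_nat; exact: leqW.
have fg p n : (`|f_ n p| <= g p)%E.
  rewrite /f_ patchE; case: ifPn => [|_].
    rewrite inE => /inbox pn; rewrite lee_fin h_bound// ler1n//.
  by rewrite abse0 lee_fin addr_ge0// sumr_ge0// => k _; rewrite mulr_ge0.
have [||| _ _] := @dominated_convergence _ _ _ (leb3 R) setT measurableT f_
    (fun p => (divX (vec3 p))%:E) g mf _ _ ig.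
- exact: (measurable_int _ int_divX).
- by apply: aeW => p _; exact: fcvg.
- by apply: aeW => p n _; exact: fg.
rewrite (_ : (fun n : nat => _) = (fun=> 0%E)).
  move/cvg_lim => /(_ _)/esym; rewrite lim_cst// => E.
  by rewrite /int3 /Rintegral E.
apply/funext => n; rewrite -integral_mkcond.
by apply: int_h.
Qed.

End divergence_theorem_proof.

(** * Spinors and Dirac matrices *)
Section complex_parts.
Context {R : realType}.
Implicit Types (x y : R[i]) (c : R).

Lemma Re_add x y : Re (x + y) = Re x + Re y. Proof. by case: x; case: y. Qed.
Lemma Im_add x y : Im (x + y) = Im x + Im y. Proof. by case: x; case: y. Qed.
Lemma Re_opp x : Re (- x) = - Re x. Proof. by case: x. Qed.
Lemma Re_mul x y : Re (x * y) = Re x * Re y - Im x * Im y.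
Proof. by case: x; case: y. Qed.
Lemma Im_mul x y : Im (x * y) = Re x * Im y + Im x * Re y.
Proof. by case: x; case: y. Qed.
Lemma Re_conjc x : Re (conjc x) = Re x. Proof. by case: x. Qed.
Lemma Im_conjc x : Im (conjc x) = - Im x. Proof. by case: x. Qed.

Lemma complex_eq x y : Re x = Re y -> Im x = Im y -> x = y.
Proof. by case: x y => a b [c d] /= -> ->. Qed.

Lemma Re_sum I (r : seq I) (P : pred I) (F : I -> R[i]) :
  Re (\sum_(i <- r | P i) F i) = \sum_(i <- r | P i) Re (F i).
Proof. by elim/big_rec2: _ => // i y1 y2 _ <-; rewrite Re_add. Qed.

Lemma Im_sum I (r : seq I) (P : pred I) (F : I -> R[i]) :
  Im (\sum_(i <- r | P i) F i) = \sum_(i <- r | P i) Im (F i).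
Proof. by elim/big_rec2: _ => // i y1 y2 _ <-; rewrite Im_add. Qed.

Lemma Re_realM c x : Re (c%:C * x) = c * Re x.
Proof. by rewrite Re_mul /= mul0r subr0. Qed.

Lemma Im_realM c x : Im (c%:C * x) = c * Im x.
Proof. by rewrite Im_mul /= mul0r addr0. Qed.

Lemma Re_natM n x : Re (n%:R * x) = n%:R * Re x.
Proof. by rewrite -(rmorph_nat (real_complex R)) Re_realM. Qed.

Lemma imag_sqr : imag * imag = -1 :> R[i].
Proof. by apply: complex_eq; rewrite /=; ring. Qed.

Lemma imag_neq0 : imag != 0 :> R[i].
Proof. by rewrite eq_complex /= oner_eq0 andbF. Qed.

Lemma imagV : imag^-1 = - imag :> R[i].
Proof.
by apply: (mulfI imag_neq0); rewrite mulfV ?imag_neq0// mulrN imag_sqr opprK.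
Qed.

End complex_parts.

Section real_inner_product.
Context {R : realType}.
Local Notation spinor := 'cV[R[i]]_4.
Implicit Types (v w z : spinor) (c : R) (M : 'M[R[i]]_4).

(** The inner product of C^4 seen as R^8. Multiplication by [imag] is skew for it, which is why
    potentials drop out of the product rule for covariant derivatives. *)
Definition rdot v w : R := Re (hdot v w).

Lemma hdotDl v w z : hdot (v + w) z = hdot v z + hdot w z.
Proof. by rewrite /hdot -big_split; apply: eq_bigr => a _; rewrite mxE mulrDl. Qed.

Lemma hdotZl (c : R[i]) v w : hdot (c *: v) w = c * hdot v w.
Proof. by rewrite /hdot mulr_sumr; apply: eq_bigr => a _; rewrite mxE mulrA. Qed.

Lemma hdotJ v w : conjc (hdot v w) = hdot w v.
Proof.
rewrite /hdot rmorph_sum; apply: eq_bigr => a _ /=.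
by rewrite rmorphM /= conjcK mulrC.
Qed.

Lemma rdotE v w : rdot v w =
  \sum_a (Re (v a 0) * Re (w a 0) + Im (v a 0) * Im (w a 0)).
Proof.
rewrite /rdot /hdot Re_sum; apply: eq_bigr => a _.
by rewrite Re_mul Re_conjc Im_conjc mulrN opprK.
Qed.

Lemma rdotC v w : rdot v w = rdot w v.
Proof. by rewrite /rdot -hdotJ Re_conjc. Qed.

Lemma rdotDl v w z : rdot (v + w) z = rdot v z + rdot w z.
Proof. by rewrite /rdot hdotDl Re_add. Qed.

Lemma rdotDr v w z : rdot z (v + w) = rdot z v + rdot z w.
Proof. by rewrite rdotC rdotDl !(rdotC z). Qed.

Lemma rdotZl c v w : rdot (c%:C *: v) w = c * rdot v w.
Proof. by rewrite /rdot hdotZl Re_mul/= mul0r subr0. Qed.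

Lemma rdotZr c v w : rdot v (c%:C *: w) = c * rdot v w.
Proof. by rewrite rdotC rdotZl rdotC. Qed.

Lemma rdotNl v w : rdot (- v) w = - rdot v w.
Proof. by rewrite -scaleN1r /rdot hdotZl mulN1r Re_opp. Qed.

Lemma rdotNr v w : rdot v (- w) = - rdot v w.
Proof. by rewrite rdotC rdotNl rdotC. Qed.

Lemma rdotBl v w z : rdot (v - w) z = rdot v z - rdot w z.
Proof. by rewrite rdotDl rdotNl. Qed.

Lemma rdotBr v w z : rdot z (v - w) = rdot z v - rdot z w.
Proof. by rewrite rdotDr rdotNr. Qed.

Lemma rdot0l w : rdot 0 w = 0.
Proof. by have := rdotDl 0 0 w; rewrite addr0 => /eqP; rewrite -subr_eq subrr => /eqP. Qed.

Lemma rdot_suml I (r : seq I) (P : pred I) (F : I -> spinor) w :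
  rdot (\sum_(i <- r | P i) F i) w = \sum_(i <- r | P i) rdot (F i) w.
Proof.
elim/big_rec2: _ => [|i y1 y2 _ <-]; first exact: rdot0l.
by rewrite rdotDl.
Qed.

Lemma rdot_imagl v w : rdot (imag *: v) w = - rdot v (imag *: w).
Proof.
rewrite (rdotC v) /rdot !hdotZl -[hdot w v]hdotJ !Re_mul Re_conjc Im_conjc /=; ring.
Qed.

Lemma Im_hdot v w : Im (hdot v w) = rdot v (imag *: w).
Proof. by rewrite rdotC /rdot hdotZl -[hdot w v]hdotJ Re_mul Re_conjc Im_conjc /=; ring. Qed.

Lemma sqnormE v : sqnorm v = rdot v v.
Proof. by rewrite rdotE /sqnorm; apply: eq_bigr => a _; rewrite !expr2. Qed.

Lemma sqnorm_ge0 v : 0 <= sqnorm v.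
Proof. by apply: sumr_ge0 => a _; rewrite addr_ge0 ?sqr_ge0. Qed.

(** Expanding [0 <= sqnorm (v + w)] and [0 <= sqnorm (v - w)] bounds twice the pairing by the sum of
    the two squares. In this form one energy controls every pairing of its terms. *)
Lemma rdot_le v w (e : R) : sqnorm v <= e -> sqnorm w <= e -> `|rdot v w| <= e.
Proof.
move=> ve we; rewrite ler_norml; apply/andP; split.
  have := sqnorm_ge0 (v + w).
  rewrite sqnormE rdotDl !rdotDr (rdotC w v) -!sqnormE; lra.
have := sqnorm_ge0 (v - w).
rewrite sqnormE rdotBl !rdotBr (rdotC w v) -!sqnormE; lra.
Qed.

Lemma sqnorm_imag v : sqnorm (imag *: v) = sqnorm v.
Proof.
by rewrite !sqnormE rdot_imagl scalerA imag_sqr scaleN1r rdotNr opprK.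
Qed.

Definition hermitian M := forall v w, hdot (M *m v) w = hdot v (M *m w).

Lemma hermitian_adjoint M : M^T = map_mx conjc M -> hermitian M.
Proof.
move=> MT v w; rewrite /hdot.
under eq_bigr do rewrite mxE mulr_suml.
under [RHS]eq_bigr do rewrite mxE rmorph_sum mulr_sumr.
rewrite exchange_big; apply: eq_bigr => a _; apply: eq_bigr => b _ /=.
have := congr1 (fun N : 'M[R[i]]_4 => N a b) MT; rewrite !mxE => ->.
by rewrite rmorphM /=; ring.
Qed.

Lemma hermitian_rdot M v w : hermitian M -> rdot (M *m v) w = rdot v (M *m w).
Proof. by move=> hM; rewrite /rdot hM. Qed.

Lemma hermitian_Im M v : hermitian M -> Im (hdot (M *m v) v) = 0.
Proof.
move=> hM; have : Im (hdot (M *m v) v) = - Im (hdot (M *m v) v).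
  by rewrite {2}hM -[X in - Im X]hdotJ Im_conjc opprK.
by move=> /eqP; rewrite -addr_eq0 -mulr2n mulrn_eq0 => /eqP.
Qed.

End real_inner_product.

(** * Clifford relations and the spin operator *)

Section dirac_matrices.
Context {R : realType}.
Local Notation alpha := (alpha R).
Local Notation beta := (Defs.beta R).
Local Notation spin := (spin R).

Lemma pauli_sqr k : pauli R k *m pauli R k = 1%:M.
Proof.
apply/matrixP => -[[|[|//]] i] -[[|[|//]] j]; case: k => -[|[|[|//]]] k;
 rewrite !mxE !big_ord_recl big_ord0 /= !mxE /=; apply: complex_eq; rewrite /=; ring.
Qed.

Lemma pauli_anticomm j k : j != k ->
  pauli R j *m pauli R k = - (pauli R k *m pauli R j).
Proof.
move=> jk; apply/matrixP => -[[|[|//]] a] -[[|[|//]] b];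
 case: j k jk => -[|[|[|//]]] j [[|[|[|//]]] k] // jk;
 rewrite !mxE !big_ord_recl !big_ord0 /= !mxE /=; apply: complex_eq; rewrite /=; ring.
Qed.

Lemma pauli_adjoint k : (pauli R k)^T = map_mx conjc (pauli R k).
Proof.
apply/matrixP => -[[|[|//]] i] -[[|[|//]] j]; case: k => -[|[|[|//]]] k;
 rewrite !mxE /=; apply: complex_eq; rewrite /=; ring.
Qed.

(* Block products are computed at dimension 2 + 2, convertible to 4. *)
Let alpha_block k : 'M[R[i]]_(2 + 2) := block_mx 0 (pauli R k) (pauli R k) 0.
Let beta_block : 'M[R[i]]_(2 + 2) := block_mx 1%:M 0 0 (- 1%:M).

Lemma alpha_sqr k : alpha k *m alpha k = 1%:M.
Proof.
have : alpha_block k *m alpha_block k = 1%:M; last exact.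
rewrite mulmx_block !mul0mx !mulmx0 !add0r !addr0 pauli_sqr.
by rewrite -scalar_mx_block.
Qed.

Lemma alpha_anticomm j k : j != k -> alpha j *m alpha k = - (alpha k *m alpha j).
Proof.
move=> jk.
have : alpha_block j *m alpha_block k = - (alpha_block k *m alpha_block j); last exact.
rewrite !mulmx_block !mul0mx !mulmx0 !add0r !addr0.
by rewrite (pauli_anticomm jk) opp_block_mx !oppr0.
Qed.

Lemma alpha_beta k : alpha k *m beta = - (beta *m alpha k).
Proof.
have : alpha_block k *m beta_block = - (beta_block *m alpha_block k); last exact.
rewrite !mulmx_block !mul0mx !mulmx0 !add0r !addr0.
rewrite !mulmxN !mulNmx !mul1mx !mulmx1 opp_block_mx.
by rewrite !oppr0 opprK.
Qed.

Lemma beta_sqr : beta *m beta = 1%:M.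
Proof.
have : beta_block *m beta_block = 1%:M; last exact.
rewrite mulmx_block !mul0mx !mulmx0 !add0r !addr0.
by rewrite mulmxN mulNmx opprK mulmx1 -scalar_mx_block.
Qed.

Lemma alpha_hermitian k : hermitian (alpha k).
Proof.
apply: hermitian_adjoint.
have : (alpha_block k)^T = map_mx conjc (alpha_block k); last exact.
rewrite tr_block_mx map_block_mx !trmx0 pauli_adjoint.
by rewrite !map_mx0.
Qed.

Lemma ordS_neq (k : 'I_3) : k + 1 != k + 2.
Proof. by case: k => -[|[|[|//]]] k. Qed.

Lemma spinE k : spin k = - (imag / 2) *: (alpha (k + 1) *m alpha (k + 2)).
Proof.
have anti := alpha_anticomm (ordS_neq k).
rewrite /Defs.spin (_ : _ - _ = 2 *: (alpha (k + 1) *m alpha (k + 2))).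
  rewrite scalerA.
  by congr (_ *: _); field.
by rewrite scaler_nat mulr2n anti.
Qed.

Lemma sqnorm_alpha k v : sqnorm (alpha k *m v) = sqnorm v.
Proof.
rewrite !sqnormE (hermitian_rdot _ _ (alpha_hermitian k)).
by rewrite mulmxA alpha_sqr mul1mx.
Qed.

Lemma hdotZr (c : R[i]) (v w : 'cV[R[i]]_4) :
  hdot v (c *: w) = conjc c * hdot v w.
Proof. by rewrite -hdotJ hdotZl rmorphM /= hdotJ. Qed.

Lemma hdotNr (v w : 'cV[R[i]]_4) : hdot v (- w) = - hdot v w.
Proof. by rewrite -scaleN1r hdotZr rmorphN rmorph1 mulN1r. Qed.

(** Passing to the adjoint reverses the product of two [alpha] and conjugates the factor;
    anticommutation and the purely imaginary factor contribute two signs that cancel. *)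
Lemma spin_hermitian k : hermitian (spin k).
Proof.
move=> v w; rewrite spinE -!scalemxAl hdotZl hdotZr.
rewrite -mulmxA alpha_hermitian alpha_hermitian mulmxA.
rewrite [X in _ = _ * hdot v (X *m w)](alpha_anticomm (ordS_neq k)).
rewrite mulNmx hdotNr mulrN -mulNr; congr (_ * _).
by apply: complex_eq; rewrite /=; ring.
Qed.

(** Every [alpha] is isometric, so [spin k] is half of an isometry. *)
Lemma sqnorm_spin_le k v : sqnorm (spin k *m v) <= sqnorm v.
Proof.
rewrite spinE -scalemxAl -mulmxA.
rewrite (_ : - (imag / 2) = (- 2^-1)%:C * imag); last first.
  by rewrite rmorphN /= fmorphV /= rmorph_nat mulNr mulrC.
rewrite -scalerA sqnormE rdotZl rdotZr -sqnormE sqnorm_imag !sqnorm_alpha.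
by have := sqnorm_ge0 v; lra.
Qed.

Lemma spin_dot_hermitian (b : 'rV[R]_3) : hermitian (spin_dot b).
Proof.
move=> v w; rewrite /spin_dot !mulmx_suml.
have hdot_sumr (F : 'I_3 -> 'cV[R[i]]_4) :
    hdot v (\sum_k F k) = \sum_k hdot v (F k).
  elim/big_ind2: _ => [|x1 y1 x2 y2 <- <-|//].
    by rewrite -(scale0r 0) hdotZr conjc0 mul0r.
  by rewrite -hdotJ hdotDl rmorphD /= !hdotJ.
have hdot_suml (F : 'I_3 -> 'cV[R[i]]_4) :
    hdot (\sum_k F k) w = \sum_k hdot (F k) w.
  elim/big_ind2: _ => [|x1 y1 x2 y2 <- <-|//]; last exact: hdotDl.
  by rewrite -(scale0r 0) hdotZl mul0r.
rewrite hdot_suml hdot_sumr; apply: eq_bigr => k _.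
by rewrite -[in LHS]scalemxAl -[in RHS]scalemxAl hdotZl hdotZr conjc_real spin_hermitian.
Qed.

Definition o0 : 'I_3 := Ordinal (isT : (0 < 3)%N).
Definition o1 : 'I_3 := Ordinal (isT : (1 < 3)%N).
Definition o2 : 'I_3 := Ordinal (isT : (2 < 3)%N).

Lemma sum3 (V : nmodType) (F : 'I_3 -> V) : \sum_k F k = F o0 + F o1 + F o2.
Proof.
rewrite !big_ord_recl big_ord0 addr0 addrA.
by congr (F _ + F _ + F _); exact: val_inj.
Qed.

Lemma ord3_add : [/\ o0 + 1 = o1, o0 + 2 = o2, o1 + 1 = o2, o1 + 2 = o0 &
  (o2 + 1 = o0) * (o2 + 2 = o1)]%R.
Proof. by split; [..|split]; exact: val_inj. Qed.

(** The algebra of the squared Dirac operator, with [h k j] standing for D_k D_j u. Diagonal terms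
    survive because [alpha k] squares to 1; off the diagonal, anticommutation turns each pair into a
    commutator of covariant derivatives, that is, into a component of the magnetic field. *)
Lemma dirac_square_sum (h : 'I_3 -> 'I_3 -> 'cV[R[i]]_4) (F : 'I_3 -> 'I_3 -> R)
    (u : 'cV[R[i]]_4) (b : 'rV[R]_3) :
  (forall k j, h k j - h j k = - (imag * (F k j)%:C) *: u) ->
  (forall l, b 0 l = F (l + 1) (l + 2)) ->
  \sum_k alpha k *m (\sum_j alpha j *m h k j) =
  \sum_k h k k + 2%:C *: (spin_dot b *m u).
Proof.
move=> hF bF.
(* The two ordered pairs of distinct indices that omit [l] together give the component of the spin
   term along [l]. *)
have pair l : alpha (l + 1) *m (alpha (l + 2) *m h (l + 1) (l + 2)) +
     alpha (l + 2) *m (alpha (l + 1) *m h (l + 2) (l + 1)) =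
     2%:C *: ((b 0 l)%:C *: spin l *m u).
  rewrite !mulmxA [X in _ + X *m _](_ : _ = - (alpha (l + 1) *m alpha (l + 2))).
    rewrite mulNmx -mulmxBr hF -bF spinE -!scalemxAl -!scalemxAr !scalerA.
    by congr (_ *: _); rewrite rmorph_nat; field.
  by rewrite (alpha_anticomm (ordS_neq l)) opprK.
have diag k : alpha k *m (alpha k *m h k k) = h k k.
  by rewrite mulmxA alpha_sqr mul1mx.
rewrite /spin_dot mulmx_suml scaler_sumr.
under [X in _ = _ + X]eq_bigr do rewrite -pair.
rewrite !sum3 !mulmxDr !diag; have [-> -> -> -> [-> ->]] := ord3_add.
move: (h o0 o0) (h o1 o1) (h o2 o2) => x0 x1 x2.
set y := fun k j => alpha k *m (alpha j *m h k j).
rewrite -![alpha _ *m (alpha _ *m h _ _)]/(y _ _).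
move: (y o0 o1) (y o0 o2) (y o1 o0) (y o1 o2) (y o2 o0) (y o2 o1) => *.
by apply/colP => a; rewrite !mxE; ring.
Qed.

End dirac_matrices.

(** * Covariant derivatives *)
Section spinor_calculus.
Context {R : realType} {V : normedModType R}.
Implicit Types (F G : V -> 'cV[R[i]]_4) (x v w : V) (n : nat).

Definition Cks n F := forall a,
  Ck n (fun x => Re (F x a 0)) /\ Ck n (fun x => Im (F x a 0)).

Definition sder v F x : 'cV[R[i]]_4 :=
  \col_a ('D_v (fun y => Re (F y a 0)) x +i* 'D_v (fun y => Im (F y a 0)) x).

Definition is_sder x v F (dF : 'cV[R[i]]_4) := forall a,
  is_derive x v (fun y => Re (F y a 0)) (Re (dF a 0)) /\
  is_derive x v (fun y => Im (F y a 0)) (Im (dF a 0)).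

Lemma is_sder_val x v F dF : is_sder x v F dF -> sder v F x = dF.
Proof.
move=> dFx; apply/colP => a; rewrite mxE; have [dr di] := dFx a.
by apply: complex_eq => /=; [exact: is_derive_val dr|exact: is_derive_val di].
Qed.

Lemma Cks_is_sder n x v F : Cks n.+1 F -> is_sder x v F (sder v F x).
Proof.
move=> CF a; have [Cr Ci] := CF a; rewrite !mxE /=.
by split; [exact: Ck_is_derive Cr|exact: Ck_is_derive Ci].
Qed.

Lemma CksW n F : Cks n.+1 F -> Cks n F.
Proof. by move=> CF a; have [Cr Ci] := CF a; split; exact: CkW. Qed.

Lemma Cks_sder n v F : Cks n.+1 F -> Cks n (sder v F).
Proof.
move=> CF a; have [Cr Ci] := CF a.
split; [under eq_fun do rewrite mxE /=|under eq_fun do rewrite mxE /=];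
  exact: Ck_derive.
Qed.

Lemma is_sder_add x v F G dF dG : is_sder x v F dF -> is_sder x v G dG ->
  is_sder x v (fun y => F y + G y) (dF + dG).
Proof.
move=> hF hG a; have [Fr Fi] := hF a; have [Gr Gi] := hG a.
rewrite !mxE Re_add Im_add; split; under eq_fun do rewrite mxE ?Re_add ?Im_add;
  exact: is_derive_add.
Qed.

Lemma Cks_add n F G : Cks n F -> Cks n G -> Cks n (fun y => F y + G y).
Proof.
move=> CF CG a; have [Fr Fi] := CF a; have [Gr Gi] := CG a.
by split; under eq_fun do rewrite mxE ?Re_add ?Im_add; exact: CkD.
Qed.

Lemma is_sder_sum I (r : seq I) (F : I -> V -> 'cV[R[i]]_4) x v dF :
  (forall i, is_sder x v (F i) (dF i)) ->
  is_sder x v (fun y => \sum_(i <- r) F i y) (\sum_(i <- r) dF i).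
Proof.
move=> hF; elim: r => [|i r IHr].
  under eq_fun do rewrite big_nil; rewrite big_nil => a; rewrite !mxE /=.
  by split; exact: is_derive_cst.
under eq_fun do rewrite big_cons.
by rewrite big_cons; exact: is_sder_add.
Qed.

Lemma Cks_sum n I (r : seq I) (F : I -> V -> 'cV[R[i]]_4) :
  (forall i, Cks n (F i)) -> Cks n (fun y => \sum_(i <- r) F i y).
Proof.
move=> CF; elim: r => [|i r IHr].
  under eq_fun do rewrite big_nil; move=> a.
  by split; under eq_fun do rewrite mxE /=; exact: Ck_cst.
by under eq_fun do rewrite big_cons; exact: Cks_add.
Qed.

Let Re_mulmx (M : 'M[R[i]]_4) (z : 'cV[R[i]]_4) a : Re ((M *m z) a 0) =
  \sum_b (Re (M a b) * Re (z b 0) - Im (M a b) * Im (z b 0)).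
Proof. by rewrite mxE Re_sum; apply: eq_bigr => b _; rewrite Re_mul. Qed.

Let Im_mulmx (M : 'M[R[i]]_4) (z : 'cV[R[i]]_4) a : Im ((M *m z) a 0) =
  \sum_b (Re (M a b) * Im (z b 0) + Im (M a b) * Re (z b 0)).
Proof. by rewrite mxE Im_sum; apply: eq_bigr => b _; rewrite Im_mul. Qed.

Lemma is_sder_mulmx (M : 'M[R[i]]_4) x v F dF : is_sder x v F dF ->
  is_sder x v (fun y => M *m F y) (M *m dF).
Proof.
move=> hF a; rewrite Re_mulmx Im_mulmx.
split; [under eq_fun do rewrite Re_mulmx|under eq_fun do rewrite Im_mulmx];
  apply: is_derive_bigsum => b; have [Fr Fi] := hF b.
- by apply: is_derive_sub; exact: is_derive_mulZ.
- by apply: is_derive_add; exact: is_derive_mulZ.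
Qed.

Lemma Cks_mulmx n (M : 'M[R[i]]_4) F : Cks n F -> Cks n (fun y => M *m F y).
Proof.
move=> CF a.
split; [under eq_fun do rewrite Re_mulmx|under eq_fun do rewrite Im_mulmx];
  apply: Ck_sum => b; have [Fr Fi] := CF b.
- by apply: CkB; exact: CkZ.
- by apply: CkD; exact: CkZ.
Qed.

Lemma is_sder_cscale (c : R[i]) x v F dF : is_sder x v F dF ->
  is_sder x v (fun y => c *: F y) (c *: dF).
Proof.
move=> /(is_sder_mulmx c%:M); rewrite mul_scalar_mx.
by under eq_fun do rewrite mul_scalar_mx.
Qed.

Lemma Cks_cscale n (c : R[i]) F : Cks n F -> Cks n (fun y => c *: F y).
Proof.
by move=> /(Cks_mulmx c%:M); under eq_fun do rewrite mul_scalar_mx.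
Qed.

Lemma is_sder_rscale (c : V -> R) dc x v F dF :
  is_derive x v c dc -> is_sder x v F dF ->
  is_sder x v (fun y => (c y)%:C *: F y) (dc%:C *: F x + (c x)%:C *: dF).
Proof.
move=> hc hF a; have [Fr Fi] := hF a.
rewrite !mxE Re_add Im_add !Re_mul !Im_mul /= !mul0r !subr0 !addr0.
split; [under eq_fun do rewrite mxE Re_mul /= mul0r subr0|
        under eq_fun do rewrite mxE Im_mul /= mul0r addr0]; exact: is_derive_mul.
Qed.

Lemma Cks_rscale n (c : V -> R) F : Ck n c -> Cks n F ->
  Cks n (fun y => (c y)%:C *: F y).
Proof.
move=> hc hF a; have [Fr Fi] := hF a.
split; [under eq_fun do rewrite mxE Re_mul /= mul0r subr0|
        under eq_fun do rewrite mxE Im_mul /= mul0r addr0]; exact: CkM.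
Qed.

Lemma is_sder_rdot x v F G dF dG : is_sder x v F dF -> is_sder x v G dG ->
  is_derive x v (fun y => rdot (F y) (G y)) (rdot dF (G x) + rdot (F x) dG).
Proof.
move=> hF hG; under eq_fun do rewrite rdotE.
rewrite !rdotE -big_split /=.
have d a : is_derive x v
    (fun y => Re (F y a 0) * Re (G y a 0) + Im (F y a 0) * Im (G y a 0))
    (Re (dF a 0) * Re (G x a 0) + Im (dF a 0) * Im (G x a 0) +
     (Re (F x a 0) * Re (dG a 0) + Im (F x a 0) * Im (dG a 0))).
  have [Fr Fi] := hF a; have [Gr Gi] := hG a.
  have dr := is_derive_add (is_derive_mul Fr Gr) (is_derive_mul Fi Gi).
  by apply: (is_derive_eq dr); ring.
exact: is_derive_bigsum d.
Qed.

Lemma Ck_rdot n F G : Cks n F -> Cks n G -> Ck n (fun y => rdot (F y) (G y)).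
Proof.
move=> CF CG; under eq_fun do rewrite rdotE; apply: Ck_sum => a.
by have [? ?] := CF a; have [? ?] := CG a; apply: CkD; exact: CkM.
Qed.

Lemma Re_sder v F a :
  (fun x => Re (sder v F x a 0)) = (fun x => 'D_v (fun y => Re (F y a 0)) x).
Proof. by apply/funext => x; rewrite mxE. Qed.

Lemma Im_sder v F a :
  (fun x => Im (sder v F x a 0)) = (fun x => 'D_v (fun y => Im (F y a 0)) x).
Proof. by apply/funext => x; rewrite mxE. Qed.

Lemma sder_sym v w F x : Cks 2 F -> sder v (sder w F) x = sder w (sder v F) x.
Proof.
move=> CF; apply/colP => a; have [Fr Fi] := CF a.
rewrite [LHS]mxE [RHS]mxE !Re_sder !Im_sder.
by rewrite (Ck_derive_sym v w x Fr) (Ck_derive_sym v w x Fi).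
Qed.

End spinor_calculus.

(** * Covariant derivatives in arbitrary directions and their commutators *)

Section covariant_derivative.
Context {R : realType} {V : normedModType R}.
Implicit Types (F G : V -> 'cV[R[i]]_4) (x v w : V) (n : nat) (a b : V -> R).

(** The potential is a parameter attached to the direction: [a = 0] gives the plain derivative, used
    in time, and a component of [A] gives a spatial covariant derivative. *)
Definition cd a v F x := sder v F x - (imag * (a x)%:C) *: F x.

Lemma cdE a v F x : cd a v F x = sder v F x + (a x)%:C *: (- imag *: F x).
Proof. by rewrite /cd scalerA mulrN scaleNr [imag * _]mulrC. Qed.

Lemma Cks_cd n a v F : Ck n a -> Cks n.+1 F -> Cks n (cd a v F).
Proof.
move=> Ca CF; rewrite (_ : cd a v F = fun x => sder v F x + (a x)%:C *: (- imag *: F x)).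
  apply: Cks_add; first exact: Cks_sder.
  by apply: Cks_rscale => //; apply: Cks_cscale; exact: CksW.
by apply/funext => x; exact: cdE.
Qed.

Lemma cd_mulmx n (M : 'M[R[i]]_4) a v F x : Cks n.+1 F ->
  cd a v (fun y => M *m F y) x = M *m cd a v F x.
Proof.
move=> CF; rewrite /cd (is_sder_val (is_sder_mulmx M (Cks_is_sder x v CF))).
by rewrite mulmxBr scalemxAr.
Qed.

Lemma cd_add n a v F G x : Cks n.+1 F -> Cks n.+1 G ->
  cd a v (fun y => F y + G y) x = cd a v F x + cd a v G x.
Proof.
move=> CF CG; rewrite /cd.
rewrite (is_sder_val (is_sder_add (Cks_is_sder x v CF) (Cks_is_sder x v CG))).
by rewrite scalerDr opprD addrACA.
Qed.

Lemma cd_sum n I (r : seq I) (F : I -> V -> 'cV[R[i]]_4) a v x :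
  (forall i, Cks n.+1 (F i)) ->
  cd a v (fun y => \sum_(i <- r) F i y) x = \sum_(i <- r) cd a v (F i) x.
Proof.
move=> CF; rewrite /cd.
rewrite (is_sder_val (is_sder_sum r (fun i => Cks_is_sder x v (CF i)))).
by rewrite scaler_sumr -sumrB.
Qed.

(** Second derivatives cancel by Schwarz, and the first-order terms and the products of the
    potentials cancel as well; what remains is the curvature, from the derivatives that fall on the
    potentials. *)
Lemma cd_comm a b v w F x : Ck 1 a -> Ck 1 b -> Cks 2 F ->
  cd a v (cd b w F) x - cd b w (cd a v F) x =
  - (imag * ('D_v b x - 'D_w a x)%:C) *: F x.
Proof.
move=> Ca Cb CF; have C1 := CksW CF.
have half c v1 w1 : Ck 1 c -> sder v1 (cd c w1 F) x =
    sder v1 (sder w1 F) x +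
    (('D_v1 c x)%:C *: (- imag *: F x) + (c x)%:C *: (- imag *: sder v1 F x)).
  move=> Cc; apply: is_sder_val.
  rewrite (_ : cd c w1 F = fun x => sder w1 F x + (c x)%:C *: (- imag *: F x)).
    apply: is_sder_add; first exact: (Cks_is_sder x v1 (Cks_sder w1 CF)).
    apply: is_sder_rscale; first exact: Ck_is_derive Cc.
    by apply: is_sder_cscale; exact: Cks_is_sder C1.
  by apply/funext => y; exact: cdE.
rewrite (cdE a v (cd b w F)) (cdE b w (cd a v F)) (half b v w)// (half a w v)//.
rewrite (sder_sym v w)// !cdE.
move: (sder w (sder v F) x) (sder v F x) (sder w F x) (F x) ('D_v b x) ('D_w a x).
move=> z zv zw z0 db da; apply/colP => k; rewrite !mxE.
rewrite rmorphB /=; ring.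
Qed.

(** The same potential acts on both factors, and multiplication by [imag] is skew: the two potential
    terms cancel. *)
Lemma is_derive_rdot_cd n m a x v F G : Cks n.+1 F -> Cks m.+1 G ->
  is_derive x v (fun y => rdot (F y) (G y))
    (rdot (cd a v F x) (G x) + rdot (F x) (cd a v G x)).
Proof.
move=> CF CG.
apply: (is_derive_eq (is_sder_rdot (Cks_is_sder x v CF) (Cks_is_sder x v CG))).
rewrite !cdE rdotDl rdotDr rdotZl rdotZr !scaleNr rdotNl rdotNr rdot_imagl.
by ring.
Qed.

End covariant_derivative.

(** * Space-time and its slices *)

Section space_time.
Context {R : realType}.
Local Notation W := (R^o * 'rV[R]_3)%type.
Implicit Types (f : 'rV[R]_3 -> R) (g : W -> R) (p v : W) (t : R) (x y : 'rV[R]_3).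

Definition time_dir : W := (1, 0).
Definition space_dir (k : 'I_3) : W := (0, delta_mx 0 k).

Lemma derivable_snd f p v : derivable f p.2 v.2 -> derivable (fun q : W => f q.2) p v.
Proof. by []. Qed.

Lemma derive_snd f p v : 'D_v (fun q : W => f q.2) p = 'D_(v.2) f p.2.
Proof. by []. Qed.

Lemma Ck_snd n f : Ck n f -> Ck n (fun q : W => f q.2).
Proof.
have csnd (h : 'rV[R]_3 -> R) : continuous h -> continuous (fun q : W => h q.2).
  by move=> ch q; apply: (@continuous_comp _ _ _ snd h); [exact: cvg_snd|exact: ch].
elim: n f => [|n IHn] f [cf df]; (split; first exact: csnd) => // v.
have [df1 df2] := df v.2; split=> [q|].
  by apply: derivable_snd; exact: df1.
by under eq_fun do rewrite derive_snd; exact: (IHn _ df2).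
Qed.

(** Equality of the difference quotients as functions carries derivability and the value of the
    derivative between a slice and space-time at once. *)
Let slice_quotient g t x (w : 'rV[R]_3) :
  (fun h => h^-1 *: (((fun y => g (t, y)) \o shift x) (h *: w) - g (t, x))) =
  (fun h => h^-1 *: ((g \o shift ((t, x) : W)) (h *: ((0, w) : W)) - g (t, x))).
Proof.
apply/funext => h /=; congr (_ *: (g _ - _)).
by congr (_, _); rewrite /= scaler0 add0r.
Qed.

Let time_quotient g t x :
  (fun h : R => h^-1 *: (((fun s => g (s, x)) \o shift t) (h *: 1) - g (t, x))) =
  (fun h => h^-1 *: ((g \o shift ((t, x) : W)) (h *: time_dir) - g (t, x))).
Proof.
apply/funext => h /=; congr (_ *: (g _ - _)).
by congr (_, _); rewrite /= scaler0 add0r.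
Qed.

Lemma derive_slice g t x (w : 'rV[R]_3) :
  'D_w (fun y => g (t, y)) x = 'D_((0, w) : W) g (t, x).
Proof. by rewrite /derive slice_quotient. Qed.

Lemma Ck_slice n g t : Ck n g -> Ck n (fun x => g (t, x)).
Proof.
have cslice (h : W -> R) : continuous h -> continuous (fun x => h (t, x)).
  move=> ch x; apply: (@continuous_comp _ _ _ (fun x => (t, x) : W) h); last exact: ch.
  exact: continuous_pairr.
elim: n g => [|n IHn] g [cg dg]; (split; first exact: cslice) => // w.
have [dg1 dg2] := dg (0, w); split=> [x|].
  by rewrite /derivable slice_quotient; exact: dg1.
by under eq_fun do rewrite derive_slice; exact: (IHn _ dg2).
Qed.

Lemma is_derive_time g t x (dg : R) : is_derive ((t, x) : W) time_dir g dg ->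
  is_derive t 1 (fun s => g (s, x)) dg.
Proof.
by case=> dx <-; apply: DeriveDef; rewrite /derivable /derive time_quotient.
Qed.

Lemma derive1_time g t x : derive1 (fun s => g (s, x)) t = 'D_time_dir g (t, x).
Proof. by rewrite derive1E /derive time_quotient. Qed.

End space_time.

(** * Integrals over R^3 *)
Section integrals_over_space.
Context {R : realType}.
Implicit Types (f g G : 'rV[R]_3 -> R).

Lemma continuous_integrable3 f G (C : R) : continuous f -> integrable3 G ->
  (forall x, `|f x| <= C * G x) -> integrable3 f.
Proof.
move=> cf iG fG; have mf : measurable_fun setT (fun p => (f (vec3 p))%:E).
  apply/measurable_EFinP; apply: continuous_measurable3 => p.
  by apply: continuous_comp; [exact: continuous_vec3|exact: cf].
apply: (@le_integrable _ _ _ (leb3 R) setT measurableT _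
  (fun p => C%:E * (G (vec3 p))%:E)%E) => //.
  by move=> p _; rewrite -EFinM /= lee_fin (le_trans (fG _))// ler_norm.
exact: integrableZl.
Qed.

Lemma integrable3D f g : integrable3 f -> integrable3 g ->
  integrable3 (fun x => f x + g x).
Proof. by move=> If Ig; exact: (integrableD measurableT If Ig). Qed.

Lemma integrable3Z (c : R) f : integrable3 f -> integrable3 (fun x => c * f x).
Proof. by move=> If; exact: (integrableZl measurableT c If). Qed.

Lemma int3D f g : integrable3 f -> integrable3 g ->
  int3 (fun x => f x + g x) = int3 f + int3 g.
Proof. by move=> If Ig; exact: (RintegralD measurableT If Ig). Qed.

Lemma int3Z (c : R) f : integrable3 f -> int3 (fun x => c * f x) = c * int3 f.
Proof. by move=> If; exact: (RintegralZl c measurableT If). Qed.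

Lemma integrable3B f g : integrable3 f -> integrable3 g ->
  integrable3 (fun x => f x - g x).
Proof. by move=> If Ig; exact: (integrableB measurableT If Ig). Qed.

Lemma int3B f g : integrable3 f -> integrable3 g ->
  int3 (fun x => f x - g x) = int3 f - int3 g.
Proof. by move=> If Ig; exact: (RintegralB measurableT If Ig). Qed.

Lemma int3_eq0 f : (forall x, f x = 0) -> int3 f = 0.
Proof.
move=> f0; rewrite /int3 /Rintegral; under eq_integral do rewrite f0.
by rewrite integral0.
Qed.

Lemma eq_int3 f g : (forall x, f x = g x) -> int3 f = int3 g.
Proof. by move=> fg; congr int3; exact/funext. Qed.

Lemma is_derive_int3 (f : R -> 'rV[R]_3 -> R) (df : R -> 'rV[R]_3 -> R)
    (G : 'rV[R]_3 -> R) (t : R) :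
  (forall s, integrable3 (f s)) ->
  (forall (s : R) x, is_derive s 1 (fun r : R => f r x) (df s x)) ->
  integrable3 G -> (forall s x, `|s - t| < 1 -> `|df s x| <= G x) ->
  is_derive t 1 (fun s : R => int3 (f s)) (int3 (df t)).
Proof.
move=> If Df IG dfG.
have tI : `]t - 1, t + 1[%classic t by rewrite /= in_itv/= ltrBlDr !ltrDl ltr01.
have near_t s : `]t - 1, t + 1[%classic s -> `|s - t| < 1.
  by rewrite /= in_itv/= ltr_norml => /andP[? ?]; apply/andP; split; lra.
have dE s p : partial1of2 (fun s p => f s (vec3 p)) s p = df s (vec3 p).
  by rewrite partial1of2E; exact: derive_val.
have der s p : `]t - 1, t + 1[%classic s -> [set: R * R * R] p ->
    derivable (fun s => f s (vec3 p)) s 1.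
  by move=> _ _; exact: (@ex_derive _ _ _ _ _ _ _ (Df s (vec3 p))).
have G0 p : 0 <= G (vec3 p).
  by apply: le_trans (dfG t (vec3 p) _); rewrite ?subrr ?normr0.
have dG s p : `]t - 1, t + 1[%classic s -> [set: R * R * R] p ->
    `|partial1of2 (fun s p => f s (vec3 p)) s p| <= G (vec3 p).
  by move=> sI _; rewrite dE; apply: dfG; exact: near_t.
have dF := @derivable_under_integral R _ _ (leb3 R) (fun s p => f s (vec3 p))
  setT measurableT t (t - 1) (t + 1) tI (fun s _ => If s) der _ G0 IG dG.
have FE := @differentiation_under_integral R _ _ (leb3 R) (fun s p => f s (vec3 p))
  setT measurableT t (t - 1) (t + 1) tI (fun s _ => If s) der _ G0 IG dG.
apply: DeriveDef => //; rewrite -derive1E FE.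
by apply: eq_Rintegral => p _; exact: dE.
Qed.

End integrals_over_space.

Section spin_pairing.
Context {R : realType}.

Lemma rdot_spin_dot (b : 'rV[R]_3) (v w : 'cV[R[i]]_4) :
  rdot (spin_dot b *m v) w = \sum_l b 0 l * rdot (spin R l *m v) w.
Proof.
rewrite /spin_dot mulmx_suml rdot_suml; apply: eq_bigr => l _.
by rewrite -scalemxAl rdotZl.
Qed.

(** Exchanging the indices sends the sum to its opposite. This makes the Hessian term real: second
    derivatives of phi are symmetric, imaginary parts of <D_j u, D_k u> antisymmetric. *)
Lemma sum_sym_antisym (P H : 'I_3 -> 'I_3 -> R) :
  (forall j k, P j k = P k j) -> (forall j k, H j k = - H k j) ->
  \sum_j \sum_k P j k * H j k = 0.
Proof.
move=> PC HN; have HC : \sum_j \sum_k P j k * H j k = - \sum_j \sum_k P j k * H j k.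
  rewrite [LHS]exchange_big -sumrN; apply: eq_bigr => j _; rewrite -sumrN.
  by apply: eq_bigr => k _; rewrite PC HN mulrN.
by move: HC => /eqP; rewrite -addr_eq0 -mulr2n mulrn_eq0 => /eqP.
Qed.

(* [g k j] stands for <D_k D_j u, D_k u> and [h k j] for <D_k D_k u, D_j u>; the
   field strength [F] enters through [D_k D_j - D_j D_k = - i F_kj]. *)
Lemma virial_algebra (phi1 lap1 : 'I_3 -> R) (phi2 F a g h db : 'I_3 -> 'I_3 -> R)
    (hu w du utd Mud lap2 s : 'I_3 -> R) (lap uu ut2 Q m : R) :
  lap = \sum_k phi2 k k ->
  (forall k j, F j k = - F k j) ->
  (forall k, h k k = g k k) ->
  \sum_j 2 * phi1 j * ((\sum_k h k j) + 2 * Mud j - m ^+ 2 * du j + utd j) +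
    lap * ((\sum_k hu k) + 2 * Q - m ^+ 2 * uu + ut2) =
  \sum_k (\sum_j 2 * (phi2 k j * a k j + phi1 j * (h k j + g k j))
    + (lap1 k * du k + lap * (hu k + a k k))
    - (phi2 k k * (\sum_j a j j) + phi1 k * (\sum_j 2 * (g j k - F j k * w j)))
    - 2^-1 * (lap2 k * uu + lap1 k * (2 * du k))
    + (phi2 k k * ut2 + phi1 k * (2 * utd k))
    - m ^+ 2 * (phi2 k k * uu + phi1 k * (2 * du k))
    + 2 * (phi2 k k * Q + phi1 k * ((\sum_l db l k * s l) + 2 * Mud k)))
  - (2 * (\sum_k \sum_j phi2 k j * a k j) - 2^-1 * (uu * \sum_k lap2 k)
     + 2 * (\sum_k (\sum_j phi1 j * F k j) * w k)
     + 2 * (\sum_l (\sum_k db l k * phi1 k) * s l)).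
Proof.
(* With the sums over three indices expanded, only the antisymmetry of [F] has to be substituted
   before the identity becomes one between polynomials with rational coefficients. *)
move=> -> FN hg; rewrite !sum3 !hg.
rewrite (FN o0 o1) (FN o0 o2) (FN o1 o2).
have F0 k : F k k = 0 by have := FN k k; lra.
rewrite !F0.
by field.
Qed.

End spin_pairing.

(** * Virial identity *)
Section virial.
Context {R : realType}.
Local Notation W := (R^o * 'rV[R]_3)%type.
Variables (m : R) (A : 'rV[R]_3 -> 'rV[R]_3) (phi : 'rV[R]_3 -> R)
  (u : R -> spinor_field R).
Hypotheses (CA : forall k, Ck 2 (fun x : 'rV[R]_3 => A x 0 k)) (Cphi : Ck 4 phi)
  (Cu : Cks 2 (fun p : W => u p.1 p.2)).
Hypothesis dirac_eq : forall t x,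
  imag *: time_derivative u t x + dirac_op m A (u t) x = 0.

(** * The Dirac equation on space-time and its square *)

Definition at_time (G : R -> spinor_field R) (p : W) := G p.1 p.2.

Definition potential k (p : W) : R := A p.2 0 k.

Definition cov_at k (F : W -> 'cV[R[i]]_4) : W -> 'cV[R[i]]_4 :=
  cd (potential k) (space_dir k) F.

Definition field_strength k j x : R :=
  partial k (fun y => A y 0 j) x - partial j (fun y => A y 0 k) x.

Lemma cov_slice k (G : R -> spinor_field R) t x :
  cov A k (G t) x = cov_at k (at_time G) (t, x).
Proof.
rewrite /cov /cov_at /cd; congr (_ - _); apply/colP => a; rewrite !mxE /partial.
congr (_ +i* _).
  exact: (derive_slice (fun p : W => Re (G p.1 p.2 a 0)) t x (delta_mx 0 k)).
exact: (derive_slice (fun p : W => Im (G p.1 p.2 a 0)) t x (delta_mx 0 k)).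
Qed.

Lemma time_slice (G : R -> spinor_field R) t x :
  time_derivative G t x = sder time_dir (at_time G) (t, x).
Proof.
apply/colP => a; rewrite !mxE; congr (_ +i* _).
  exact: (derive1_time (fun p : W => Re (G p.1 p.2 a 0)) t x).
exact: (derive1_time (fun p : W => Im (G p.1 p.2 a 0)) t x).
Qed.

Let U := at_time u.
Let Ut := sder time_dir U.

Lemma at_time_derivative : at_time (time_derivative u) = Ut.
Proof. by apply/funext => -[t x]; exact: time_slice. Qed.

Let CU : Cks 2 U. Proof. exact: Cu. Qed.
Let CU1 : Cks 1 U. Proof. exact: CksW. Qed.
Let CUt : Cks 1 Ut. Proof. exact: Cks_sder. Qed.
Let Cpot k : Ck 2 (potential k). Proof. exact: (Ck_snd (CA k)). Qed.
Let CD k : Cks 1 (cov_at k U).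
Proof. by apply: Cks_cd => //; exact: CkW. Qed.

Lemma cd_time (F : W -> 'cV[R[i]]_4) : cd (fun=> 0) time_dir F = sder time_dir F.
Proof. by apply/funext => p; rewrite /cd mulr0 scale0r subr0. Qed.

Let derive_potential (v : W) k p :
  'D_v (potential k) p = 'D_(v.2) (fun y => A y 0 k) p.2.
Proof. exact: (derive_snd (fun y => A y 0 k)). Qed.

(** [A] does not depend on time and the time potential is 0, so the curvature in the planes
    containing the time axis vanishes. *)
Lemma cov_at_time_comm k p :
  sder time_dir (cov_at k U) p = cov_at k Ut p.
Proof.
have C0 : Ck 1 (fun _ : W => 0 : R) by exact: Ck_cst.
have := cd_comm time_dir (space_dir k) p C0 (CkW (Cpot k)) CU.
rewrite !cd_time derive_potential derive0 derive_cst subrr mulr0 oppr0 scale0r.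
by move=> /eqP; rewrite subr_eq0 => /eqP.
Qed.

Lemma cov_at_comm k j p : cov_at k (cov_at j U) p - cov_at j (cov_at k U) p =
  - (imag * (field_strength k j p.2)%:C) *: U p.
Proof.
have := cd_comm (space_dir k) (space_dir j) p (CkW (Cpot k)) (CkW (Cpot j)) CU.
by rewrite !derive_potential.
Qed.

(** The equation multiplied by [- imag], the inverse of [imag], and solved for u_t. *)
Let UtE : Ut = fun p =>
  \sum_k alpha R k *m cov_at k U p + (imag * m%:C) *: (Defs.beta R *m U p).
Proof.
apply/funext => -[t x].
have := dirac_eq t x; rewrite time_slice -/U -/Ut /dirac_op.
rewrite (eq_bigr _ (fun k _ => congr1 (mulmx (alpha R k)) (cov_slice k u t x))).
rewrite -[u t x]/(U (t, x)).
move: (\sum_k _) (Ut _) (Defs.beta R *m _) => z zt zb /(congr1 (fun z => - imag *: z)).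
rewrite imagV scaler0 !scalerDr !scalerA !mulNr !mulrN imag_sqr !opprK scale1r.
by move=> /eqP; rewrite scaleN1r scaleNr -opprD addr_eq0 opprK => /eqP.
Qed.

(** The mass part of the squared operator: [beta] anticommutes with every [alpha k], so the cross
    terms cancel, and [imag * m] times [beta] squares to [- m ^+ 2]. *)
Let mass_comm (v w : 'cV[R[i]]_4) (z : 'I_3 -> 'cV[R[i]]_4) :
  w = \sum_k alpha R k *m z k + (imag * m%:C) *: (Defs.beta R *m v) ->
  \sum_k alpha R k *m ((imag * m%:C) *: (Defs.beta R *m z k)) +
    (imag * m%:C) *: (Defs.beta R *m w) = - (m ^+ 2)%:C *: v.
Proof.
move=> ->; rewrite mulmxDr scalerDr mulmx_sumr scaler_sumr addrA -big_split /=.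
rewrite big1 ?add0r => [|k _].
  rewrite -scalemxAr mulmxA beta_sqr mul1mx scalerA; congr (_ *: _).
  by rewrite mulrACA imag_sqr mulN1r rmorphXn expr2.
by rewrite -scalemxAr !mulmxA alpha_beta mulNmx scalerN addNr.
Qed.

(** The equation is differentiated in time, then D_k u_t and u_t are replaced by means of the
    equation itself. At most two derivatives fall on u. *)
Let UttE p : sder time_dir Ut p =
  \sum_k cov_at k (cov_at k U) p +
  2%:C *: (spin_dot (curl A p.2) *m U p) - (m ^+ 2)%:C *: U p.
Proof.
have CaD k : Cks 1 (fun q => alpha R k *m cov_at k U q) by exact: (Cks_mulmx _ (CD k)).
have CbU : Cks 1 (fun q => (imag * m%:C) *: (Defs.beta R *m U q)).
  by apply: Cks_cscale; exact: Cks_mulmx.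
have dtUt : sder time_dir Ut p = \sum_k alpha R k *m cov_at k Ut p +
    (imag * m%:C) *: (Defs.beta R *m Ut p).
  rewrite {1}UtE; apply: is_sder_val; apply: is_sder_add.
    apply: is_sder_sum => k; apply: is_sder_mulmx.
    by rewrite -cov_at_time_comm; exact: Cks_is_sder.
  by apply: is_sder_cscale; apply: is_sder_mulmx; exact: Cks_is_sder.
have dkUt k : cov_at k Ut p = \sum_j alpha R j *m cov_at k (cov_at j U) p +
    (imag * m%:C) *: (Defs.beta R *m cov_at k U p).
  rewrite {1}UtE.
  have CsU : Cks 1 (fun q => \sum_j alpha R j *m cov_at j U q).
    by apply: Cks_sum => j; exact: CaD.
  apply: (etrans (@cd_add _ _ 0 _ _ _ _ _ CsU CbU)); congr (_ + _).
    apply: (etrans (@cd_sum _ _ 0 _ _ _ _ _ _ CaD)).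
    by apply: eq_bigr => j _; exact: (@cd_mulmx _ _ 0 _ _ _ _ _ (CD j)).
  under eq_fun do rewrite -mul_scalar_mx mulmxA.
  by rewrite (@cd_mulmx _ _ 0 _ _ _ _ _ CU1) -mulmxA mul_scalar_mx.
rewrite dtUt; under eq_bigr do rewrite dkUt mulmxDr.
rewrite big_split /= -addrA.
rewrite (mass_comm (v := U p) (w := Ut p) (congr1 (@^~ p) UtE)).
rewrite scaleNr; congr (_ - _).
apply: (dirac_square_sum (F := fun k j => field_strength k j p.2)) => [k j|l].
  exact: cov_at_comm.
by rewrite mxE.
Qed.

(** * Density, flux and the local conservation law *)

Let phi1 k := partial k phi.
Let lap := laplacian phi.
Let magn l := fun x => curl A x 0 l.

Lemma Ck_partial n k (f : 'rV[R]_3 -> R) : Ck n.+1 f -> Ck n (partial k f).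
Proof. exact: Ck_derive. Qed.

Let Cphi1 k : Ck 3 (phi1 k). Proof. exact: Ck_partial. Qed.

Let Clap : Ck 2 lap.
Proof. by apply: Ck_sum => k; exact: Ck_partial (Cphi1 k). Qed.

Let Clap1 k : Ck 1 (partial k lap). Proof. exact: Ck_partial. Qed.

Let Cmagn l : Ck 1 (magn l).
Proof.
rewrite /magn; under eq_fun do rewrite mxE.
by apply: CkB; apply: Ck_partial; exact: CA.
Qed.

Lemma is_derive_space n (f : 'rV[R]_3 -> R) k (p : W) : Ck n.+1 f ->
  is_derive p (space_dir k) (fun q : W => f q.2) (partial k f p.2).
Proof. by move=> /(@Ck_snd _ n.+1) /Ck_is_derive; exact. Qed.

Lemma is_derive_static n (f : 'rV[R]_3 -> R) (p : W) : Ck n.+1 f ->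
  is_derive p time_dir (fun q : W => f q.2) 0.
Proof.
move=> /(@Ck_snd _ n.+1) Cf.
by apply: (is_derive_eq (Ck_is_derive p time_dir Cf)); rewrite derive_snd derive0.
Qed.

Let spinU l (p : W) := rdot (spin R l *m U p) (U p).

Let is_derive_spinU l k p : is_derive p (space_dir k) (spinU l)
  (2 * rdot (spin R l *m U p) (cov_at k U p)).
Proof.
have CS : Cks 1 (fun q => spin R l *m U q) by exact: (Cks_mulmx _ CU1).
apply: (is_derive_eq (is_derive_rdot_cd (potential k) p (space_dir k) CS CU1)).
rewrite (@cd_mulmx _ _ 0 _ _ _ _ _ CU1) (hermitian_rdot _ _ (spin_hermitian l)).
by rewrite rdotC -/(cov_at k U p); ring.
Qed.

Definition virial_density (p : W) : R :=
  \sum_j 2 * (phi1 j p.2 * rdot (Ut p) (cov_at j U p)) + lap p.2 * rdot (Ut p) (U p).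

(* The vector field whose divergence is the time derivative of [virial_density]
   plus [virial_lhs_density]. *)
Definition virial_flux k (p : W) : R :=
  \sum_j 2 * (phi1 j p.2 * rdot (cov_at k U p) (cov_at j U p))
  + lap p.2 * rdot (cov_at k U p) (U p)
  - phi1 k p.2 * (\sum_j rdot (cov_at j U p) (cov_at j U p))
  - 2^-1 * (partial k lap p.2 * rdot (U p) (U p))
  + phi1 k p.2 * rdot (Ut p) (Ut p)
  - m ^+ 2 * (phi1 k p.2 * rdot (U p) (U p))
  + 2 * (phi1 k p.2 * \sum_l magn l p.2 * spinU l p).

(** A real integrand for [virial_lhs]: the imaginary part in the magnetic term is written as the
    real pairing with [imag *: cov_at k U p], and the inner sum over [j] is the [k]-th component of
    grad phi /\ B. *)
Definition virial_lhs_density (p : W) : R :=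
  2 * (\sum_k \sum_j partial k (phi1 j) p.2 * rdot (cov_at k U p) (cov_at j U p))
  - 2^-1 * (rdot (U p) (U p) * \sum_k partial k (partial k lap) p.2)
  + 2 * (\sum_k (\sum_j phi1 j p.2 * field_strength k j p.2) *
           rdot (U p) (imag *: cov_at k U p))
  + 2 * (\sum_l (\sum_k partial k (magn l) p.2 * phi1 k p.2) * spinU l p).

Lemma is_derive_virial_density p : is_derive p time_dir virial_density
  (\sum_j 2 * phi1 j p.2 * (rdot (sder time_dir Ut p) (cov_at j U p)
                            + rdot (Ut p) (cov_at j Ut p))
   + lap p.2 * (rdot (sder time_dir Ut p) (U p) + rdot (Ut p) (Ut p))).
Proof.
have dUt := Cks_is_sder p time_dir CUt.
have dj j := is_derive_mul (is_derive_static p (Cphi1 j))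
  (is_sder_rdot dUt (Cks_is_sder p time_dir (CD j))).
have ds := is_derive_bigsum (index_enum 'I_3) (fun j => is_derive_mulZ 2 (dj j)).
have dl := is_derive_mul (is_derive_static p Clap)
  (is_sder_rdot dUt (Cks_is_sder p time_dir CU1)).
apply: (is_derive_eq (is_derive_add ds dl)); congr (_ + _).
  by apply: eq_bigr => j _; rewrite cov_at_time_comm; ring.
by rewrite -/Ut; ring.
Qed.

Lemma is_derive_virial_flux k p : is_derive p (space_dir k) (virial_flux k)
  (\sum_j 2 * (partial k (phi1 j) p.2 * rdot (cov_at k U p) (cov_at j U p)
     + phi1 j p.2 * (rdot (cov_at k (cov_at k U) p) (cov_at j U p)
                     + rdot (cov_at k U p) (cov_at k (cov_at j U) p)))
  + (partial k lap p.2 * rdot (cov_at k U p) (U p)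
     + lap p.2 * (rdot (cov_at k (cov_at k U) p) (U p)
                  + rdot (cov_at k U p) (cov_at k U p)))
  - (partial k (phi1 k) p.2 * (\sum_j rdot (cov_at j U p) (cov_at j U p))
     + phi1 k p.2 * (\sum_j (rdot (cov_at k (cov_at j U) p) (cov_at j U p)
                             + rdot (cov_at j U p) (cov_at k (cov_at j U) p))))
  - 2^-1 * (partial k (partial k lap) p.2 * rdot (U p) (U p)
            + partial k lap p.2 * (rdot (cov_at k U p) (U p) + rdot (U p) (cov_at k U p)))
  + (partial k (phi1 k) p.2 * rdot (Ut p) (Ut p)
     + phi1 k p.2 * (rdot (cov_at k Ut p) (Ut p) + rdot (Ut p) (cov_at k Ut p)))
  - m ^+ 2 * (partial k (phi1 k) p.2 * rdot (U p) (U p)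
     + phi1 k p.2 * (rdot (cov_at k U p) (U p) + rdot (U p) (cov_at k U p)))
  + 2 * (partial k (phi1 k) p.2 * (\sum_l magn l p.2 * spinU l p)
     + phi1 k p.2 * (\sum_l (partial k (magn l) p.2 * spinU l p
           + magn l p.2 * (2 * rdot (spin R l *m U p) (cov_at k U p)))))).
Proof.
have dphi j := is_derive_space k p (Cphi1 j).
have dlap := is_derive_space k p Clap.
have dlap1 := is_derive_space k p (Clap1 k).
have dmagn l := is_derive_space k p (Cmagn l).
have dr F G : Cks 1 F -> Cks 1 G ->
    is_derive p (space_dir k) (fun q => rdot (F q) (G q))
      (rdot (cov_at k F p) (G p) + rdot (F p) (cov_at k G p)).
  by move=> CF CG; exact: (is_derive_rdot_cd (potential k) p (space_dir k) CF CG).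
have dUU := dr _ _ CU1 CU1.
have dDD i j := dr _ _ (CD i) (CD j).
have t1 := is_derive_bigsum (index_enum 'I_3)
  (fun j => is_derive_mulZ 2 (is_derive_mul (dphi j) (dDD k j))).
have t2 := is_derive_mul dlap (dr _ _ (CD k) CU1).
have t3 := is_derive_mul (dphi k) (is_derive_bigsum (index_enum 'I_3) (fun j => dDD j j)).
have t4 := is_derive_mulZ 2^-1 (is_derive_mul dlap1 dUU).
have t5 := is_derive_mul (dphi k) (dr _ _ CUt CUt).
have t6 := is_derive_mulZ (m ^+ 2) (is_derive_mul (dphi k) dUU).
have t7 := is_derive_mulZ 2 (is_derive_mul (dphi k)
  (is_derive_bigsum (index_enum 'I_3)
    (fun l => is_derive_mul (dmagn l) (is_derive_spinU l k p)))).
exact: (is_derive_add (is_derive_sub (is_derive_add (is_derive_sub (is_derive_sub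
  (is_derive_add t1 t2) t3) t4) t5) t6) t7).
Qed.

Let field_strengthN k j x : field_strength j k x = - field_strength k j x.
Proof. by rewrite /field_strength opprB. Qed.

(** Exchanging the order of two covariant derivatives costs a multiple of the field strength: this
    is the origin of the magnetic term. *)
Let rdot_cov_comm k j p :
  rdot (cov_at k (cov_at j U) p) (cov_at j U p) =
  rdot (cov_at j (cov_at k U) p) (cov_at j U p) -
  field_strength j k p.2 * rdot (U p) (imag *: cov_at j U p).
Proof.
have := cov_at_comm j k p.
move: (cov_at j (cov_at k U) p) (cov_at k (cov_at j U) p) (cov_at j U p) (U p).
move=> z1 z2 z3 z4 /eqP; rewrite subr_eq => /eqP ->.
by rewrite rdotDl scaleNr rdotNl [imag * _]mulrC -scalerA rdotZl rdot_imagl; ring.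
Qed.

(** Used with [z] equal to D_j u and to u, the two factors that meet u_tt in the derivative of the
    density. *)
Let rdot_Utt p (z : 'cV[R[i]]_4) : rdot (sder time_dir Ut p) z =
  (\sum_k rdot (cov_at k (cov_at k U) p) z) +
  2 * (\sum_l magn l p.2 * rdot (spin R l *m U p) z) - m ^+ 2 * rdot z (U p).
Proof.
rewrite UttE rdotBl rdotDl rdot_suml.
by congr (_ + _ - _); rewrite rdotZl; [rewrite rdot_spin_dot|rewrite rdotC].
Qed.

Lemma virial_pointwise p : 'D_time_dir virial_density p =
  (\sum_k 'D_(space_dir k) (virial_flux k) p) - virial_lhs_density p.
Proof.
pose a k j := rdot (cov_at k U p) (cov_at j U p).
pose g k j := rdot (cov_at k (cov_at j U) p) (cov_at k U p).
pose h k j := rdot (cov_at k (cov_at k U) p) (cov_at j U p).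
pose hu k := rdot (cov_at k (cov_at k U) p) (U p).
pose w k := rdot (U p) (imag *: cov_at k U p).
pose du k := rdot (cov_at k U p) (U p).
pose utd k := rdot (Ut p) (cov_at k Ut p).
pose Mud k := \sum_l magn l p.2 * rdot (spin R l *m U p) (cov_at k U p).
pose Q := \sum_l magn l p.2 * spinU l p.
have alg := @virial_algebra R (fun k => phi1 k p.2) (fun k => partial k lap p.2)
  (fun k j => partial k (phi1 j) p.2) (fun k j => field_strength k j p.2) a g h
  (fun l k => partial k (magn l) p.2) hu w du utd Mud
  (fun k => partial k (partial k lap) p.2) (fun l => spinU l p) (lap p.2)
  (rdot (U p) (U p)) (rdot (Ut p) (Ut p)) Q m erefl
  (fun k j => field_strengthN k j p.2) (fun k => erefl).
rewrite (is_derive_val (is_derive_virial_density p)).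
apply: (etrans _ (etrans alg _)).
  congr (_ + _).
    by apply: eq_bigr => j _; rewrite (rdot_Utt p (cov_at j U p)).
  by rewrite (rdot_Utt p (U p)).
congr (_ - _); apply: eq_bigr => k _.
rewrite (is_derive_val (is_derive_virial_flux k p)).
have eq7 (a1 a2 a3 a4 a5 a6 a7 b1 b2 b3 b4 b5 b6 b7 : R) :
    a1 = b1 -> a2 = b2 -> a3 = b3 -> a4 = b4 -> a5 = b5 -> a6 = b6 -> a7 = b7 ->
    a1 + a2 - a3 - a4 + a5 - a6 + a7 = b1 + b2 - b3 - b4 + b5 - b6 + b7.
  by do 7 move=> ->.
apply: eq7.
- apply: eq_bigr => j _.
  by rewrite (rdotC (cov_at k U p) (cov_at k (cov_at j U) p)).
- by [].
(* The only flux term in which covariant derivatives change order; the other ones need at most the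
   symmetry of the pairing. *)
- congr (_ + _ * _); apply: eq_bigr => j _.
  rewrite (rdotC (cov_at j U p) (cov_at k (cov_at j U) p)) rdot_cov_comm /g /w.
  by rewrite mulr_natl mulr2n.
- by rewrite (rdotC (U p) (cov_at k U p)) -/(du k) [2 * du k]mulr_natl mulr2n.
- by rewrite (rdotC (cov_at k Ut p) (Ut p)) -/(utd k) [2 * utd k]mulr_natl mulr2n.
- by rewrite (rdotC (U p) (cov_at k U p)) -/(du k) [2 * du k]mulr_natl mulr2n.
- congr (_ * (_ + _ * _)); rewrite big_split /=; congr (_ + _).
  by rewrite /Mud mulr_sumr; apply: eq_bigr => l _; rewrite mulrCA.
Qed.

Lemma Ck_virial_density : Ck 1 virial_density.
Proof.
apply: CkD; last by apply: CkM; [exact: Ck_snd (CkW Clap)|exact: Ck_rdot].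
apply: Ck_sum => j; apply: CkZ; apply: CkM; last exact: Ck_rdot.
by apply: Ck_snd; exact: Ck_le (Cphi1 j).
Qed.

Lemma Ck_virial_flux k : Ck 1 (virial_flux k).
Proof.
have Cp j : Ck 1 (fun p : W => phi1 j p.2).
  by apply: Ck_snd; exact: (@Ck_le _ _ 3).
have Cl : Ck 1 (fun p : W => lap p.2) by exact: Ck_snd (CkW Clap).
have Cl1 : Ck 1 (fun p : W => partial k lap p.2) by exact: Ck_snd (Clap1 k).
have CUU : Ck 1 (fun p => rdot (U p) (U p)) by exact: Ck_rdot.
have CDD i j : Ck 1 (fun p => rdot (cov_at i U p) (cov_at j U p)).
  exact: (Ck_rdot (CD i) (CD j)).
have CDU i : Ck 1 (fun p => rdot (cov_at i U p) (U p)) by exact: (Ck_rdot (CD i)).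
have Ctt : Ck 1 (fun p => rdot (Ut p) (Ut p)) by exact: Ck_rdot.
have CQ : Ck 1 (fun p : W => \sum_l magn l p.2 * spinU l p).
  apply: Ck_sum => l; apply: CkM; first exact: Ck_snd (Cmagn l).
  exact: (Ck_rdot (Cks_mulmx _ CU1) CU1).
have Cs : Ck 1 (fun p => \sum_j rdot (cov_at j U p) (cov_at j U p)).
  by apply: Ck_sum => j; exact: CDD.
have Ch : Ck 1 (fun p : W =>
    \sum_j 2 * (phi1 j p.2 * rdot (cov_at k U p) (cov_at j U p))).
  by apply: Ck_sum => j; exact: (CkZ 2 (CkM (Cp j) (CDD k j))).
exact: (CkD (CkB (CkD (CkB (CkB (CkD Ch (CkM Cl (CDU k))) (CkM (Cp k) Cs))
  (CkZ _ (CkM Cl1 CUU))) (CkM (Cp k) Ctt)) (CkZ _ (CkM (Cp k) CUU)))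
  (CkZ 2 (CkM (Cp k) CQ))).
Qed.

(** * Domination by weight times energy *)

Let phi_sum x := \sum_(1 <= k < 5) \sum_(s : k.-tuple 'I_3) `|partials s phi x|.

Let field_sum x := 1 + enorm (curl A x) + \sum_i \sum_j `|Dcurl A x i j|.

Let phi_sum_ge0 x : 0 <= phi_sum x.
Proof. by apply: sumr_ge0 => k _; apply: sumr_ge0. Qed.

Let enorm_ge0 (v : 'rV[R]_3) : 0 <= enorm v.
Proof. exact: sqrtr_ge0. Qed.

(** The summand 1 lets the same weight bound the coefficients that contain no magnetic factor. *)
Let field_sum_ge1 x : 1 <= field_sum x.
Proof.
rewrite /field_sum -addrA lerDl addr_ge0 ?enorm_ge0//.
by apply: sumr_ge0 => i _; apply: sumr_ge0.
Qed.

Let partials_le (s : seq 'I_3) x : (0 < size s < 5)%N ->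
  `|partials s phi x| <= phi_sum x.
Proof.
move=> ss; rewrite /phi_sum (bigD1_seq (size s)) ?iota_uniq ?mem_index_iota//=.
rewrite (bigD1 (in_tuple s))//= -addrA lerDl addr_ge0//.
  by apply: sumr_ge0.
by apply: sumr_ge0 => k _; apply: sumr_ge0.
Qed.

Let magn_le l x : `|magn l x| <= field_sum x.
Proof.
have le_en : `|magn l x| <= enorm (curl A x).
  rewrite -sqrtr_sqr /enorm ler_wsqrtr// /dotp (bigD1 l)//= expr2 lerDl.
  by apply: sumr_ge0 => k _; rewrite -expr2 sqr_ge0.
rewrite (le_trans le_en)// /field_sum -addrA addrCA lerDl addr_ge0//.
by apply: sumr_ge0 => i _; apply: sumr_ge0.
Qed.

Let dmagn_le l k x : `|partial k (magn l) x| <= field_sum x.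
Proof.
have -> : partial k (magn l) x = Dcurl A x l k by rewrite mxE.
have le1 : `|Dcurl A x l k| <= \sum_j `|Dcurl A x l j|.
  by rewrite (bigD1 k)//= lerDl sumr_ge0.
have le2 : \sum_j `|Dcurl A x l j| <= \sum_i \sum_j `|Dcurl A x i j|.
  by rewrite [leRHS](bigD1 l)//= lerDl; apply: sumr_ge0 => i _; apply: sumr_ge0.
by have := enorm_ge0 (curl A x); rewrite /field_sum; lra.
Qed.

Let weight_bounded (c : 'rV[R]_3 -> R) := exists2 C : R, 0 <= C &
  forall x, `|c x| <= C * weight A phi x.

Let weightE x : weight A phi x = phi_sum x * field_sum x. Proof. by []. Qed.

Let weight_ge0 x : 0 <= weight A phi x.
Proof. by rewrite weightE mulr_ge0// (le_trans ler01). Qed.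

Let weight_bounded_partials s : (0 < size s < 5)%N -> weight_bounded (partials s phi).
Proof.
move=> ss; exists 1 => // x; rewrite mul1r weightE.
by rewrite (le_trans (partials_le x ss))// ler_peMr.
Qed.

Let weight_bounded_partials_magn s l : (0 < size s < 5)%N ->
  weight_bounded (fun x => partials s phi x * magn l x).
Proof.
move=> ss; exists 1 => // x; rewrite mul1r weightE normrM ler_pM//.
exact: partials_le.
Qed.

Let weight_bounded_partials_dmagn s l k : (0 < size s < 5)%N ->
  weight_bounded (fun x => partial k (magn l) x * partials s phi x).
Proof.
move=> ss; exists 1 => // x; rewrite mul1r weightE mulrC normrM ler_pM//.
exact: partials_le.
Qed.

Let weight_bounded_sum (c : 'I_3 -> 'rV[R]_3 -> R) : (forall j, weight_bounded (c j)) ->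
  weight_bounded (fun x => \sum_j c j x).
Proof.
move=> wc.
have /choice[C CP] j : exists C, 0 <= C /\ forall x, `|c j x| <= C * weight A phi x.
  by have [C C0 CP] := wc j; exists C.
exists (\sum_j C j); first by apply: sumr_ge0 => j _; exact: (CP j).1.
move=> x; rewrite mulr_suml (le_trans (ler_norm_sum _ _ _))//.
by apply: ler_sum => j _; exact: (CP j).2.
Qed.

Let energy (p : W) := energy_density A u p.1 p.2.

Let dominated (f : W -> R) := exists2 C : R, 0 <= C &
  forall p, `|f p| <= C * (weight A phi p.2 * energy p).

Let energy_terms (p : W) : energy p =
  sqnorm (U p) + sqnorm (Ut p) + sqnorm (sder time_dir Ut p) +
  \sum_k (sqnorm (cov_at k U p) + sqnorm (cov_at k Ut p)).
Proof.
case: p => t x.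
have covE k : sqnorm (cov A k (u t) x) + sqnorm (cov A k (time_derivative u t) x) =
    sqnorm (cov_at k U (t, x)) + sqnorm (cov_at k Ut (t, x)).
  by rewrite (cov_slice k u) (cov_slice k (time_derivative u)) at_time_derivative.
have utE : time_derivative u t x = Ut (t, x) by exact: time_slice.
have uttE : time_derivative (time_derivative u) t x = sder time_dir Ut (t, x).
  by rewrite (time_slice (time_derivative u)) at_time_derivative.
rewrite -(eq_bigr _ (fun k _ => covE k)) -utE -uttE.
by [].
Qed.

Let cov_energy_ge0 (p : W) :
  0 <= \sum_k (sqnorm (cov_at k U p) + sqnorm (cov_at k Ut p)).
Proof. by apply: sumr_ge0 => k _; rewrite addr_ge0 ?sqnorm_ge0. Qed.

Let energy_ge0 p : 0 <= energy p.
Proof. by rewrite energy_terms !addr_ge0 ?sqnorm_ge0. Qed.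

Let energy_U p : sqnorm (U p) <= energy p.
Proof.
have := cov_energy_ge0 p; rewrite energy_terms.
by have := sqnorm_ge0 (Ut p); have := sqnorm_ge0 (sder time_dir Ut p); lra.
Qed.

Let energy_Ut p : sqnorm (Ut p) <= energy p.
Proof.
have := cov_energy_ge0 p; rewrite energy_terms.
by have := sqnorm_ge0 (U p); have := sqnorm_ge0 (sder time_dir Ut p); lra.
Qed.

Let energy_Utt p : sqnorm (sder time_dir Ut p) <= energy p.
Proof.
have := cov_energy_ge0 p; rewrite energy_terms.
by have := sqnorm_ge0 (U p); have := sqnorm_ge0 (Ut p); lra.
Qed.

Let energy_cov p k :
  sqnorm (cov_at k U p) + sqnorm (cov_at k Ut p) <= energy p.
Proof.
rewrite energy_terms (bigD1 k)//=.
have : 0 <= \sum_(j < 3 | j != k) (sqnorm (cov_at j U p) + sqnorm (cov_at j Ut p)).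
  by apply: sumr_ge0 => j _; rewrite addr_ge0 ?sqnorm_ge0.
have := sqnorm_ge0 (U p); have := sqnorm_ge0 (Ut p).
by have := sqnorm_ge0 (sder time_dir Ut p); lra.
Qed.

Let energy_D k p : sqnorm (cov_at k U p) <= energy p.
Proof. by have := energy_cov p k; have := sqnorm_ge0 (cov_at k Ut p); lra. Qed.

Let energy_Dt k p : sqnorm (cov_at k Ut p) <= energy p.
Proof. by have := energy_cov p k; have := sqnorm_ge0 (cov_at k U p); lra. Qed.

(** The elementary estimate, coefficient against weight and pairing against energy. The density, its
    time derivative, the flux and the left-hand side are all combinations of such terms. *)
Let dominated_rdot (c : 'rV[R]_3 -> R) (F G : W -> 'cV[R[i]]_4) : weight_bounded c ->
  (forall p, sqnorm (F p) <= energy p) -> (forall p, sqnorm (G p) <= energy p) ->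
  dominated (fun p => c p.2 * rdot (F p) (G p)).
Proof.
move=> [C C0 CP] FE GE; exists C => // p; rewrite mulrA normrM ler_pM//.
exact: rdot_le.
Qed.

Let dominated_add f g : dominated f -> dominated g ->
  dominated (fun p => f p + g p).
Proof.
move=> [C C0 CP] [D D0 DP]; exists (C + D); first exact: addr_ge0.
by move=> p; rewrite mulrDl (le_trans (ler_normD _ _))// lerD.
Qed.

Let dominated_scale (c : R) f : dominated f -> dominated (fun p => c * f p).
Proof.
move=> [C C0 CP]; exists (`|c| * C); first exact: mulr_ge0.
by move=> p; rewrite normrM -mulrA ler_wpM2l.
Qed.

Let dominated_sub f g : dominated f -> dominated g ->
  dominated (fun p => f p - g p).
Proof.
move=> df /(dominated_scale (-1)) dg.
by under eq_fun do rewrite -mulN1r; exact: dominated_add.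
Qed.

Let dominated_sum (f : 'I_3 -> W -> R) : (forall j, dominated (f j)) ->
  dominated (fun p => \sum_j f j p).
Proof.
move=> df; under eq_fun do rewrite sum3.
by apply: dominated_add => //; exact: dominated_add.
Qed.

Hypothesis domination : forall T : R, exists2 G : 'rV[R]_3 -> R, integrable3 G &
  forall t x, `|t| <= T -> weight A phi x * energy_density A u t x <= G x.

Let integrable_slice f t : continuous (fun x => f (t, x)) -> dominated f ->
  integrable3 (fun x => f (t, x)).
Proof.
move=> cf [C C0 CP]; have [G IG GP] := domination `|t|.
apply: (continuous_integrable3 (C := C) cf IG) => x.
by rewrite (le_trans (CP (t, x)))// ler_wpM2l// GP.
Qed.

Let integrable_Ck n f t : Ck n f -> dominated f -> integrable3 (fun x => f (t, x)).
Proof.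
by move=> Cf; apply: integrable_slice; exact: (Ck_continuous (Ck_slice t Cf)).
Qed.

Let partial_sum n k (f : 'I_3 -> 'rV[R]_3 -> R) : (forall j, Ck n.+1 (f j)) ->
  partial k (fun x => \sum_j f j x) = fun x => \sum_j partial k (f j) x.
Proof.
move=> Cf; apply/funext => x; apply: is_derive_val; apply: is_derive_bigsum => j.
exact: Ck_is_derive (Cf j).
Qed.

Let C2phi k j : Ck 2 (partial k (phi1 j)). Proof. exact: Ck_partial. Qed.

(** Derivatives of the Laplacian are spelled out as sums of iterated partial derivatives of phi, the
    quantities that the weight controls. *)
Let lap1E k : partial k lap = fun x => \sum_j partial k (partial j (phi1 j)) x.
Proof. exact: (partial_sum k (fun j => C2phi j j)). Qed.

Let lap2E k i : partial i (partial k lap) =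
  fun x => \sum_j partial i (partial k (partial j (phi1 j))) x.
Proof.
rewrite lap1E; apply: (@partial_sum 0) => j; exact: Ck_partial (C2phi j j).
Qed.

Let weight_bounded_phi1 j : weight_bounded (phi1 j). Proof. exact: (@weight_bounded_partials [:: j]). Qed.

Let weight_bounded_phi2 k j : weight_bounded (partial k (phi1 j)).
Proof. exact: (@weight_bounded_partials [:: k; j]). Qed.

Let weight_bounded_lap : weight_bounded lap.
Proof. by apply: weight_bounded_sum => k; exact: (@weight_bounded_partials [:: k; k]). Qed.

Let weight_bounded_lap1 k : weight_bounded (partial k lap).
Proof. by rewrite lap1E; apply: weight_bounded_sum => j; exact: (@weight_bounded_partials [:: k; j; j]). Qed.

Let weight_bounded_lap2 : weight_bounded (fun x => \sum_k partial k (partial k lap) x).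
Proof.
apply: weight_bounded_sum => k; rewrite lap2E; apply: weight_bounded_sum => j.
exact: (@weight_bounded_partials [:: k; k; j; j]).
Qed.

Let energy_spin l p : sqnorm (spin R l *m U p) <= energy p.
Proof. exact: le_trans (sqnorm_spin_le l _) (energy_U p). Qed.

Let energy_iD k p : sqnorm (imag *: cov_at k U p) <= energy p.
Proof. by rewrite sqnorm_imag. Qed.

Lemma dominated_density : dominated virial_density.
Proof.
apply: dominated_add; last exact: (dominated_rdot weight_bounded_lap energy_Ut energy_U).
apply: dominated_sum => j; apply: dominated_scale.
exact: (dominated_rdot (weight_bounded_phi1 j) energy_Ut (energy_D j)).
Qed.

(** After time differentiation u_tt and D_j u_t appear; for them the energy contains squares beyond
    those of u, u_t and D_j u. *)
Lemma dominated_density_derive :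
  dominated (fun p => 'D_time_dir virial_density p).
Proof.
under eq_fun do rewrite (is_derive_val (is_derive_virial_density _)).
apply: dominated_add; last first.
  under eq_fun do rewrite mulrDr.
  apply: dominated_add; first exact: (dominated_rdot weight_bounded_lap energy_Utt energy_U).
  exact: (dominated_rdot weight_bounded_lap energy_Ut energy_Ut).
apply: dominated_sum => j; under eq_fun do rewrite -mulrA mulrDr.
apply: dominated_scale; apply: dominated_add.
  exact: (dominated_rdot (weight_bounded_phi1 j) energy_Utt (energy_D j)).
exact: (dominated_rdot (weight_bounded_phi1 j) energy_Ut (energy_Dt j)).
Qed.

Lemma dominated_flux k : dominated (virial_flux k).
Proof.
have dr c F G := @dominated_rdot c F G.
apply: dominated_add; last first.
  apply: dominated_scale; under eq_fun do rewrite mulr_sumr.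
  apply: dominated_sum => l; under eq_fun do rewrite mulrA.
  apply: (dr (fun x => phi1 k x * magn l x)) => //.
  exact: (@weight_bounded_partials_magn [:: k]).
apply: dominated_sub; last exact: (dominated_scale _ (dr _ _ _ (weight_bounded_phi1 k) energy_U energy_U)).
apply: dominated_add; last exact: (dr _ _ _ (weight_bounded_phi1 k) energy_Ut energy_Ut).
apply: dominated_sub; last exact: (dominated_scale _ (dr _ _ _ (weight_bounded_lap1 k) energy_U energy_U)).
apply: dominated_sub; last first.
  under eq_fun do rewrite mulr_sumr; apply: dominated_sum => j.
  exact: (dr _ _ _ (weight_bounded_phi1 k) (energy_D j) (energy_D j)).
apply: dominated_add; last exact: (dr _ _ _ weight_bounded_lap (energy_D k) energy_U).
apply: dominated_sum => j; apply: dominated_scale.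
exact: (dr _ _ _ (weight_bounded_phi1 j) (energy_D k) (energy_D j)).
Qed.

(** * The four terms of the left-hand side *)

Let hess (p : W) :=
  \sum_k \sum_j partial k (phi1 j) p.2 * rdot (cov_at k U p) (cov_at j U p).
Let bilap (p : W) := rdot (U p) (U p) * \sum_k partial k (partial k lap) p.2.
Let magnetic (p : W) := \sum_k (\sum_j phi1 j p.2 * field_strength k j p.2) *
  rdot (U p) (imag *: cov_at k U p).
Let spinor_term (p : W) :=
  \sum_l (\sum_k partial k (magn l) p.2 * phi1 k p.2) * spinU l p.

Let lhs_densityE p : virial_lhs_density p =
  2 * hess p - 2^-1 * bilap p + 2 * magnetic p + 2 * spinor_term p.
Proof. by []. Qed.

Let dominated_hess : dominated hess.
Proof.
apply: dominated_sum => k; apply: dominated_sum => j.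
exact: (dominated_rdot (weight_bounded_phi2 k j) (energy_D k) (energy_D j)).
Qed.

Let dominated_bilap : dominated bilap.
Proof.
rewrite /bilap; under eq_fun do rewrite mulrC.
exact: (dominated_rdot weight_bounded_lap2 energy_U energy_U).
Qed.

Let dominated_spinor_term : dominated spinor_term.
Proof.
apply: dominated_sum => l.
apply: (@dominated_rdot (fun x => \sum_k partial k (magn l) x * phi1 k x)) => //.
by apply: weight_bounded_sum => k; exact: (@weight_bounded_partials_dmagn [:: k]).
Qed.

(** In dimension 3 the antisymmetric field strength acts on vectors as a vector product with the
    curl. *)
Let magnetic_vectorE k x : \sum_j phi1 j x * field_strength k j x =
  phi1 (k + 1) x * magn (k + 2) x - phi1 (k + 2) x * magn (k + 1) x.
Proof.
have [e01 e02 e11 e12 [e21 e22]] := ord3_add.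
(* The derivatives of [A] are hidden behind an arbitrary matrix [d], so that each case becomes a
   polynomial identity in its entries. *)
have [d [fsE mE]] : exists d : 'I_3 -> 'I_3 -> R,
    (forall k j, field_strength k j x = d k j - d j k) /\
    (forall l, magn l x = d (l + 1) (l + 2) - d (l + 2) (l + 1)).
  exists (fun k j => partial k (fun y => A y 0 j) x); split=> // l.
  by rewrite /magn mxE.
have [->|[->|->]] : k = o0 \/ (k = o1 \/ k = o2).
- by case: k => -[|[|[|//]]] k; [left|right; left|right; right]; exact: val_inj.
- rewrite sum3 e01 e02 !fsE !mE ?e01 ?e02 ?e11 ?e12 ?e21 ?e22.
  by move: (phi1 o0 x) (phi1 o1 x) (phi1 o2 x) => a b c; ring.
- rewrite sum3 e11 e12 !fsE !mE ?e01 ?e02 ?e11 ?e12 ?e21 ?e22.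
  by move: (phi1 o0 x) (phi1 o1 x) (phi1 o2 x) => a b c; ring.
- rewrite sum3 e21 e22 !fsE !mE ?e01 ?e02 ?e11 ?e12 ?e21 ?e22.
  by move: (phi1 o0 x) (phi1 o1 x) (phi1 o2 x) => a b c; ring.
Qed.

Let dominated_magnetic : dominated magnetic.
Proof.
apply: dominated_sum => k; under eq_fun do rewrite magnetic_vectorE mulrBl.
apply: dominated_sub.
  apply: (@dominated_rdot (fun x => phi1 (k + 1) x * magn (k + 2) x)) => //.
  exact: (@weight_bounded_partials_magn [:: k + 1]).
apply: (@dominated_rdot (fun x => phi1 (k + 2) x * magn (k + 1) x)) => //.
exact: (@weight_bounded_partials_magn [:: k + 2]).
Qed.

Let C0phi1 j : Ck 0 (fun p : W => phi1 j p.2).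
Proof. exact: (Ck_snd (@Ck_le _ _ 3 0 _ isT (Cphi1 j))). Qed.

Let CU0 : Cks 0 U. Proof. exact: CksW. Qed.

Let CD0 k : Cks 0 (cov_at k U). Proof. exact: CksW. Qed.

Let Ck_hess : Ck 0 hess.
Proof.
apply: Ck_sum => k; apply: Ck_sum => j; apply: CkM.
  exact: (Ck_snd (@Ck_le _ _ 2 0 _ isT (C2phi k j))).
exact: (Ck_rdot (CD0 k) (CD0 j)).
Qed.

Let Ck_bilap : Ck 0 bilap.
Proof.
apply: CkM; first exact: (Ck_rdot CU0 CU0).
by apply: Ck_sum => k; exact: (Ck_snd (Ck_partial k (Clap1 k))).
Qed.

Let Ck_magnetic : Ck 0 magnetic.
Proof.
have Cm l : Ck 0 (fun p : W => magn l p.2) by exact: Ck_snd (CkW (Cmagn l)).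
apply: Ck_sum => k; apply: CkM; last exact: (Ck_rdot CU0 (Cks_cscale _ (CD0 k))).
under eq_fun do rewrite magnetic_vectorE.
exact: (CkB (CkM (C0phi1 _) (Cm _)) (CkM (C0phi1 _) (Cm _))).
Qed.

Let Ck_spinor_term : Ck 0 spinor_term.
Proof.
apply: Ck_sum => l; apply: CkM; last exact: (Ck_rdot (Cks_mulmx _ CU0) CU0).
apply: Ck_sum => k; apply: CkM; last exact: C0phi1.
exact: (Ck_snd (Ck_partial k (Cmagn l))).
Qed.

Let int_hess t := integrable_Ck t Ck_hess dominated_hess.
Let int_bilap t := integrable_Ck t Ck_bilap dominated_bilap.
Let int_magnetic t := integrable_Ck t Ck_magnetic dominated_magnetic.
Let int_spinor_term t := integrable_Ck t Ck_spinor_term dominated_spinor_term.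

Let int_lhs t : integrable3 (fun x => virial_lhs_density (t, x)).
Proof.
under eq_fun do rewrite lhs_densityE.
exact: (integrable3D (integrable3D (integrable3B (integrable3Z 2 (int_hess t))
  (integrable3Z 2^-1 (int_bilap t))) (integrable3Z 2 (int_magnetic t)))
  (integrable3Z 2 (int_spinor_term t))).
Qed.

Let int3_lhs t : int3 (fun x => virial_lhs_density (t, x)) =
  2 * int3 (fun x => hess (t, x)) - 2^-1 * int3 (fun x => bilap (t, x)) +
  2 * int3 (fun x => magnetic (t, x)) + 2 * int3 (fun x => spinor_term (t, x)).
Proof.
under eq_int3 => x do rewrite lhs_densityE.
have I1 := integrable3Z 2 (int_hess t).
have I2 := integrable3Z 2^-1 (int_bilap t).
have I3 := integrable3Z 2 (int_magnetic t).
have I4 := integrable3Z 2 (int_spinor_term t).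
rewrite (int3D (integrable3D (integrable3B I1 I2) I3) I4).
rewrite (int3D (integrable3B I1 I2) I3) (int3B I1 I2).
by rewrite (int3Z 2 (int_hess t)) (int3Z _ (int_bilap t))
  (int3Z _ (int_magnetic t)) (int3Z _ (int_spinor_term t)).
Qed.

(** * Integration of the conservation law *)

Let flux_partial k t : partial k (fun x => virial_flux k (t, x)) =
  fun x => 'D_(space_dir k) (virial_flux k) (t, x).
Proof. by apply/funext => x; exact: (derive_slice (virial_flux k)). Qed.

Let int_density_derive t :
  integrable3 (fun x => 'D_time_dir virial_density (t, x)).
Proof.
exact: (integrable_Ck t (Ck_derive time_dir Ck_virial_density)
  dominated_density_derive).
Qed.

Let int3_density_derive t :
  int3 (fun x => 'D_time_dir virial_density (t, x)) =
  - int3 (fun x => virial_lhs_density (t, x)).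
Proof.
have divE x : \sum_k partial k (fun x => virial_flux k (t, x)) x =
    'D_time_dir virial_density (t, x) + virial_lhs_density (t, x).
  rewrite virial_pointwise subrK; apply: eq_bigr => k _.
  by rewrite flux_partial.
(* Integrability is read off the right-hand side of [divE], whose two summands are dominated. *)
have int_div : integrable3 (fun x => \sum_k partial k (fun x => virial_flux k (t, x)) x).
  by rewrite (funext divE); exact: integrable3D.
have := int3_divergence_eq0 (X := fun k x => virial_flux k (t, x)).
have -> : int3 (fun x => \sum_k partial k (fun x => virial_flux k (t, x)) x) =
    int3 (fun x => 'D_time_dir virial_density (t, x)) +
    int3 (fun x => virial_lhs_density (t, x)).
  by rewrite (eq_int3 divE) int3D.
move=> div0; apply/eqP; rewrite -addr_eq0; apply/eqP; apply: div0 => [k|k x|k|k|].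
- exact: (Ck_continuous (Ck_slice t (Ck_virial_flux k))).
- exact: (Ck_derivable (Ck_slice t (Ck_virial_flux k))).
- exact: (Ck_continuous (Ck_partial k (Ck_slice t (Ck_virial_flux k)))).
- exact: (integrable_Ck t (Ck_virial_flux k) (dominated_flux k)).
- exact: int_div.
Qed.

Let F (t : R) := int3 (fun x => virial_density (t, x)).

Let is_derive_F (t : R) : is_derive t 1 F (- int3 (fun x => virial_lhs_density (t, x))).
Proof.
rewrite -int3_density_derive.
have [C C0 CP] := dominated_density_derive.
(* The bound must hold for all [s] with [|s - t| < 1], hence the [+ 1]. *)
have [G IG GP] := domination (`|t| + 1).
apply: (is_derive_int3 (f := fun s x => virial_density (s, x))
  (df := fun s x => 'D_time_dir virial_density (s, x)) (G := fun x => C * G x)).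
- by move=> s; exact: (integrable_Ck s Ck_virial_density dominated_density).
- by move=> s x; apply: is_derive_time; exact: Ck_is_derive Ck_virial_density.
- exact: integrable3Z.
- move=> s x st; apply: (le_trans (CP (s, x))); rewrite ler_wpM2l// GP//.
  by have := ler_normD (s - t) t; rewrite subrK; lra.
Qed.

Let functionalE : virial_functional A phi u = F.
Proof.
apply/funext => t; rewrite /virial_functional /=; apply: eq_int3 => x.
rewrite Re_add Re_natM Re_sum mulr_sumr (time_slice u); congr (_ + _).
  by apply: eq_bigr => j _; rewrite Re_realM (cov_slice j u).
by rewrite mulrC Re_realM.
Qed.

Let cint3_hess t :
  cint3 (fun x => \sum_j \sum_k (partial j (partial k phi) x)%:C *
           hdot (cov A j (u t) x) (cov A k (u t) x)) =
  (int3 (fun x => hess (t, x)))%:C.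
Proof.
apply: complex_eq => /=.
  apply: eq_int3 => x; rewrite Re_sum; apply: eq_bigr => j _; rewrite Re_sum.
  by apply: eq_bigr => k _; rewrite Re_realM (cov_slice j u) (cov_slice k u).
apply: int3_eq0 => x; rewrite Im_sum.
under eq_bigr do rewrite Im_sum.
under eq_bigr do under eq_bigr do rewrite Im_realM.
apply: (sum_sym_antisym (P := fun j k => partial j (partial k phi) x)
  (H := fun j k => Im (hdot (cov A j (u t) x) (cov A k (u t) x)))) => j k.
  exact: (Ck_derive_sym _ _ _ (@Ck_le _ _ 4 2 _ isT Cphi)).
by rewrite -[hdot (cov A k _ _) _]hdotJ Im_conjc opprK.
Qed.

Let cint3_spin t :
  cint3 (fun x => hdot (spin_dot (gradient phi x *m (Dcurl A x)^T) *m u t x) (u t x)) =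
  (int3 (fun x => spinor_term (t, x)))%:C.
Proof.
apply: complex_eq => /=.
  apply: eq_int3 => x; rewrite -[LHS]/(rdot _ _) rdot_spin_dot.
  apply: eq_bigr => l _; congr (_ * _); rewrite mxE; apply: eq_bigr => k _.
  by rewrite !mxE mulrC.
by apply: int3_eq0 => x; exact: (hermitian_Im _ (spin_dot_hermitian _)).
Qed.

Let Im_cint3_magnetic t :
  Im (cint3 (fun x => \sum_j (cross (gradient phi x) (curl A x) 0 j)%:C *
           hdot (u t x) (cov A j (u t) x))) = int3 (fun x => magnetic (t, x)).
Proof.
apply: eq_int3 => x; rewrite Im_sum; apply: eq_bigr => k _.
rewrite Im_realM (cov_slice k u) Im_hdot magnetic_vectorE; congr (_ * _).
by rewrite !mxE /magn !mxE.
Qed.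

Let int3_bilap t :
  int3 (fun x => sqnorm (u t x) * laplacian (laplacian phi) x) =
  int3 (fun x => bilap (t, x)).
Proof. by apply: eq_int3 => x; rewrite sqnormE. Qed.

Lemma virial_identity_cross :
  virial_identity A phi (fun x => cross (gradient phi x) (curl A x)) u.
Proof.
move=> t; rewrite functionalE; split.
  exact: (@ex_derive _ _ _ _ _ _ _ (is_derive_F t)).
have -> : derive1 F t = - int3 (fun x => virial_lhs_density (t, x)).
  by rewrite derive1E; exact: (is_derive_val (is_derive_F t)).
rewrite opprK int3_lhs /virial_lhs cint3_hess cint3_spin Im_cint3_magnetic int3_bilap.
move: (int3 _) (int3 _) (int3 _) (int3 _) => i1 i2 i3 i4.
by rewrite !rmorphD rmorphN !rmorphM fmorphV !rmorph_nat.
Qed.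

End virial.

(** * Radial multipliers *)
Section radial_multiplier.
Context {R : realType}.

(** The chain rule for [s |-> s * c] along the line through [x] treats all scalars alike, [c = 0]
    and negative ones included. *)
Lemma Ck_deriveZ_dir (V : normedModType R) (f : V -> R) (c : R) (v x : V) :
  Ck 1 f -> 'D_(c *: v) f x = c * 'D_v f x.
Proof.
move=> Cf.
have df p y : derivable f y p by exact: Ck_derivable Cf.
have dv := is_derive_line x 0 (df v).
have dcv := is_derive_line x 0 (df (c *: v)).
rewrite !scale0r !addr0 in dv dcv.
have dc : is_derive (0 : R) 1 (fun s : R => s * c) c.
  by apply: is_derive_affine => h; rewrite addr0 mul0r addr0 -[h *: 1]/(h * 1) mulr1.
have dv' : is_derive ((fun s : R => s * c) 0) 1 (fun s : R => f (x + s *: v)) ('D_v f x).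
  by rewrite mul0r.
have dcomp := @is_derive1_comp R (fun s => f (x + s *: v)) ( *%R^~ c) 0 _ _ dv' dc.
rewrite [RHS]mulrC -(is_derive_val dcv) -(is_derive_val dcomp).
suff -> : (fun s : R => f (x + s *: (c *: v))) = (fun s => f (x + s *: v)) \o *%R^~ c by [].
by apply/funext => s /=; rewrite scalerA.
Qed.

(* For [w] orthogonal to [x], s |-> phi (x + s w) is even. *)
Lemma radial_derive_tangent (phi : 'rV[R]_3 -> R) (x w : 'rV[R]_3) :
  radial phi -> Ck 1 phi -> dotp x w = 0 -> 'D_w phi x = 0.
Proof.
move=> rphi Cphi xw.
have DN : 'D_(- w) phi x = 'D_w phi x.
  have E : (fun h : R => h^-1 *: ((phi \o shift x) (h *: - w) - phi x)) =
           (fun h : R => h^-1 *: ((phi \o shift x) (h *: w) - phi x)).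
    apply/funext => h /=; congr (_ *: (_ - _)); apply: rphi.
    rewrite /enorm /dotp; congr (Num.sqrt _); move: xw; rewrite /dotp !sum3 !mxE.
    move=> xw0; apply/eqP; rewrite -subr_eq0; apply/eqP.
    by rewrite -[RHS](mulr0 (- 4 * h)) -xw0; ring.
  by rewrite /derive E.
(* The derivatives along [w] and [- w] add up to 0 and are equal by evenness, so both vanish. *)
have := Ck_deriveD_dir w (- w) x Cphi; rewrite subrr derive0 DN => /esym/eqP.
by rewrite -mulr2n mulrn_eq0 => /eqP.
Qed.

Lemma radial_gradient_parallel (phi : 'rV[R]_3 -> R) (x : 'rV[R]_3) j k :
  radial phi -> Ck 1 phi -> x 0 j * partial k phi x = x 0 k * partial j phi x.
Proof.
move=> rphi Cphi.
(* The velocity at [x] of the rotation in the plane of axes [j] and [k], tangent to the sphere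
   through [x]. *)
pose w : 'rV[R]_3 := x 0 j *: delta_mx 0 k + (- x 0 k) *: delta_mx 0 j.
have xw : dotp x w = 0.
  have dotD (y z : 'rV[R]_3) : dotp x (y + z) = dotp x y + dotp x z.
    by rewrite /dotp -big_split; apply: eq_bigr => i _; rewrite mxE mulrDr.
  have dotE (c : R) l : dotp x (c *: delta_mx 0 l) = c * x 0 l.
    rewrite /dotp (bigD1 l)//= big1 ?addr0 => [|i il].
      by rewrite !mxE !eqxx mulr1 mulrC.
    by rewrite !mxE (negbTE il) andbF !mulr0.
  by rewrite /w dotD !dotE; ring.
have := radial_derive_tangent rphi Cphi xw.
rewrite /w (Ck_deriveD_dir _ _ _ Cphi) !(Ck_deriveZ_dir _ _ _ Cphi) mulNr.
by move=> /eqP; rewrite subr_eq0 => /eqP.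
Qed.

Lemma cross0l (w : 'rV[R]_3) : cross 0 w = 0.
Proof. by apply/rowP => k; rewrite !mxE !mul0r subrr. Qed.

Lemma crossZl (c : R) (v w : 'rV[R]_3) : cross (c *: v) w = c *: cross v w.
Proof. by apply/rowP => k; rewrite !mxE; ring. Qed.

Lemma radial_magnetic_vector (phi : 'rV[R]_3 -> R) (A : 'rV[R]_3 -> 'rV[R]_3) x :
  radial phi -> Ck 1 phi ->
  radial_derivative phi x *: curl_tau A x = cross (gradient phi x) (curl A x).
Proof.
move=> rphi Cphi.
have par j k := radial_gradient_parallel x j k rphi Cphi.
have dot_ge0 : 0 <= dotp x x by apply: sumr_ge0 => k _; rewrite -expr2 sqr_ge0.
(* At the origin both sides vanish: the inverse of 0 is 0, which kills [curl_tau], and every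
   direction is orthogonal to [x = 0], so the gradient is 0. *)
have [x0|xn0] := eqVneq (enorm x) 0.
  have dx0 : dotp x x = 0.
    by move: x0 => /eqP; rewrite sqrtr_eq0 => ?; apply/eqP; rewrite eq_le dot_ge0 andbT.
  have xk k : x 0 k = 0.
    apply/eqP; rewrite -sqrf_eq0 expr2; apply/eqP/le_anti; rewrite -expr2 sqr_ge0 andbT.
    rewrite -dx0 /dotp (bigD1 k)//= -expr2 lerDl.
    by apply: sumr_ge0 => j _; rewrite -expr2 sqr_ge0.
  have g0 k : partial k phi x = 0.
    apply: radial_derive_tangent => //; apply: big1 => j _; rewrite xk mul0r //.
  have -> : gradient phi x = 0 by apply/rowP => k; rewrite !mxE g0.
  by rewrite /curl_tau x0 invr0 scale0r cross0l scaler0.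
have gradE k : partial k phi x = radial_derivative phi x * ((enorm x)^-1 * x 0 k).
  have r2 : enorm x ^+ 2 = \sum_j x 0 j * x 0 j by rewrite sqr_sqrtr.
  have -> : radial_derivative phi x = (enorm x)^-1 * \sum_j x 0 j * partial j phi x.
    rewrite /radial_derivative /dotp mulr_sumr; apply: eq_bigr => j _.
    by rewrite !mxE mulrA.
  set S := \sum_j _.
  (* Parallelism of [x] and the gradient moves the index [k] from the coordinate to the derivative,
     leaving the sum of the squared coordinates. *)
  have SE : x 0 k * S = enorm x ^+ 2 * partial k phi x.
    rewrite r2 mulr_sumr mulr_suml; apply: eq_bigr => j _.
    by rewrite mulrCA -par mulrA.
  apply: (@mulfI _ (enorm x ^+ 2)); first by rewrite expf_neq0.
  by rewrite -SE; field.
have -> : gradient phi x = radial_derivative phi x *: ((enorm x)^-1 *: x).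
  by apply/rowP => k; rewrite !mxE gradE.
by rewrite crossZl.
Qed.

End radial_multiplier.

Theorem theorem1p2 (R : realType) (m : R) (A : 'rV[R]_3 -> 'rV[R]_3)
    (phi : 'rV[R]_3 -> R) (f : 'rV[R]_3 -> 'cV[R[i]]_4)
    (u : R -> 'rV[R]_3 -> 'cV[R[i]]_4) :
  assumption_A m A ->
  virial_regular A phi u ->
  dirac_solution m A f u ->
  (radial phi ->
     virial_identity A phi (fun x => radial_derivative phi x *: curl_tau A x) u)
  /\ virial_identity A phi (fun x => cross (gradient phi x) (curl A x)) u.
Proof.
move=> _ [CA Cphi Cu dom] [dirac_eq _].
have cross_id := virial_identity_cross CA Cphi Cu dirac_eq dom.
split=> // rphi.
rewrite (_ : (fun x => _) = (fun x => cross (gradient phi x) (curl A x))) //.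
apply/funext => x; apply: radial_magnetic_vector => //.
exact: (@Ck_le _ _ 4 1 _ isT Cphi).
Qed.
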